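(* Let $d\in\mathbb{N}$, let $V:\mathbb{Z}^d\to\mathbb{R}$, and let $H_V=-\Delta+V$ be the discrete Schrödinger operator on $\ell^2(\mathbb{Z}^d)$. If there exists $s\in\mathbb{N}_0$ such that $$V_n\geq 2d-\sum_{j=1}^{d}\left[\left(\frac{|n|}{|n+\delta_j|}\right)^{d/2}\prod_{i=1}^{s}\sqrt{\frac{\log_i|n|}{\log_i|n+\delta_j|}}+\left(\frac{|n|}{|n-\delta_j|}\right)^{d/2}\prod_{i=1}^{s}\sqrt{\frac{\log_i|n|}{\log_i|n-\delta_j|}}\right]$$ for all $n\in\mathbb{Z}^d$ with $|n|$ sufficiently large, then $4d\notin\sigma_{\mathrm{p}}(H_V)$ or $4d\neq\sup\sigma(H_V)$. In particular, this is the case if, for some $s\in\mathbb{N}_0$, $$V_n\geq-\frac{d(4-d)}{4|n|^2}-\frac{1}{|n|^2}\sum_{j=1}^{s}\prod_{k=1}^{j}\frac{1}{\log_k|n|}$$ for all $n\in\mathbb{Z}^d$ with $|n|$ sufficiently large.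
   Context: The discrete Laplacian is $(-\Delta\psi)_n:=\sum_{m\in\mathbb{Z}^d,\,|m-n|=1}(\psi_n-\psi_m)$ for $\psi:\mathbb{Z}^d\to\mathbb{C}$, $n\in\mathbb{Z}^d$, where $|\cdot|$ is the Euclidean norm; it is a bounded self-adjoint operator on $\ell^2(\mathbb{Z}^d)$ with spectrum $[0,4d]$. A potential $V:\mathbb{Z}^d\to\mathbb{R}$ is identified with the multiplication operator $(V\psi)_n=V_n\psi_n$ on its maximal domain $\{\psi\in\ell^2(\mathbb{Z}^d): V\psi\in\ell^2(\mathbb{Z}^d)\}$, and $H_V:=-\Delta+V$ is self-adjoint on this domain. $\sigma(H)$ and $\sigma_{\mathrm{p}}(H)$ denote the spectrum and the point spectrum (set of eigenvalues). $\delta_j$ is the $j$-th standard basis vector of $\mathbb{Z}^d$. Iterated logarithms: $\log_0x:=x$ and $\log_{k}x:=\log(\log_{k-1}x)$ for $k\in\mathbb{N}$ ($x$ large enough). Empty sums equal $0$ and empty products equal $1$. $\mathbb{N}=\{1,2,\dots\}$, $\mathbb{N}_0=\mathbb{N}\cup\{0\}$. *)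

(* Defs.v *)
From HB Require Import structures.
From mathcomp Require Import all_boot all_order all_algebra.
From mathcomp Require Import complex.
From mathcomp Require Import all_classical all_reals all_analysis.

Set Implicit Arguments.
Unset Strict Implicit.
Unset Printing Implicit Defensive.

Import Order.TTheory GRing.Theory Num.Theory.

Local Open Scope classical_set_scope.
Local Open Scope ring_scope.
Local Open Scope complex_scope.

Section HilbertSpace.
Context {R : realType} {I : choiceType}.
Implicit Types (psi : I -> R[i]) (z : R[i]).

Definition ell2 : set (I -> R[i]) :=
  [set psi | summable [set: I] (fun n => (Normc.normc (psi n) ^+ 2)%:E)].

(* Only meaningful on [ell2]: elsewhere the infinite sum is sent to 0. *)
Definition ell2_norm psi : R :=
  Num.sqrt (fine (\esum_(n in [set: I]) (Normc.normc (psi n) ^+ 2)%:E)).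

(* A possibly unbounded operator in ell2. The values of [op_act] outside of
   [op_dom] are irrelevant. *)
Record operator := Operator {
  op_dom : set (I -> R[i]) ;
  op_act : (I -> R[i]) -> I -> R[i] }.

Implicit Types (H : operator).

Definition shifted H z psi : I -> R[i] := fun n => op_act H psi n - z * psi n.

(* z is in the resolvent set when H - z : dom H -> ell2 is a bijection with
   bounded inverse. *)
Definition resolvent_set H : set R[i] :=
  [set z | set_bij (op_dom H) ell2 (shifted H z) /\
     exists c : R, forall psi, op_dom H psi ->
       ell2_norm psi <= c * ell2_norm (shifted H z psi)].

Definition spectrum H : set R[i] := ~` resolvent_set H.

Definition point_spectrum H : set R[i] :=
  [set z | exists psi, [/\ op_dom H psi, psi <> (fun=> 0) &
     forall n, op_act H psi n = z * psi n]].

(* For self-adjoint H the spectrum is real, so that no point of it is lost by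
   taking the supremum over real points only; the value is +oo when the
   spectrum is unbounded above. *)
Definition sup_spectrum H : \bar R :=
  ereal_sup [set x%:E | x in [set x : R | spectrum H x%:C]].

End HilbertSpace.
Arguments operator : clear implicits.

Section Lattice.
Context {R : realType} {d : nat}.
Local Notation Zd := 'rV[int]_d.

Definition enorm (n : Zd) : R := Num.sqrt (\sum_(j < d) (n 0 j)%:~R ^+ 2).

Definition delta (j : 'I_d) : Zd := delta_mx 0 j.

Definition neg_laplacian (psi : Zd -> R[i]) : Zd -> R[i] :=
  fun n => \sum_(m \in [set m : Zd | enorm (m - n) = 1]) (psi n - psi m).

Definition potential_op (V : Zd -> R) (psi : Zd -> R[i]) : Zd -> R[i] :=
  fun n => (V n)%:C * psi n.

Definition schrodinger (V : Zd -> R) : operator R Zd := {|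
  op_dom := [set psi | ell2 psi /\ ell2 (potential_op V psi)] ;
  op_act := fun psi n => neg_laplacian psi n + potential_op V psi n |}.

(* "for all n with |n| sufficiently large" *)
Definition for_large (P : Zd -> Prop) : Prop :=
  exists r : R, forall n : Zd, r <= enorm n -> P n.

(* As [ln] vanishes on nonpositive reals, this is the iterated logarithm only
   for x large enough (depending on k). *)
Definition iter_log (k : nat) (x : R) : R := iter k (@ln R) x.

Definition weight_ratio (s : nat) (n m : Zd) : R :=
  (enorm n / enorm m) `^ (d%:R / 2) *
  \prod_(1 <= i < s.+1)
    Num.sqrt (iter_log i (enorm n) / iter_log i (enorm m)).

End Lattice.

(* Main.v *)
(** Conjugating by (-1)^(n_1 + ... + n_d) turns 4d - H_V into K = -Delta - V.
    If 4d is both an eigenvalue and the top of the spectrum, then K >= 0 and K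
    has a strictly positive ground state phi in l^2 with K phi = 0. The weight
    u_n = |n|^(-d/2) (log_1 |n| ... log_s |n|)^(-1/2) satisfies K u <= 0 near
    infinity, and its square sums to O(1) over the dyadic shells. Testing the
    form of K with cutoffs of w = (c u - phi)_+ at scale N gives form values
    O(1/N^2), hence K w = 0 and then w = 0, because a nonnegative solution with
    a zero vanishes. Thus c u <= phi near infinity, which is impossible since u
    is not in l^2. The explicit potential is handled by a third order Taylor
    expansion of u as a function of |n|^2: all derivatives of this function
    alternate in sign, so the remainder can be dropped. *)

Require Import Defs.
From HB Require Import structures.
From mathcomp Require Import all_boot all_order all_algebra.
From mathcomp Require Import complex.
From mathcomp Require Import all_classical all_reals all_analysis.
From mathcomp Require Import ring lra zify.

Set Implicit Arguments.
Unset Strict Implicit.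
Unset Printing Implicit Defensive.

Import Order.TTheory GRing.Theory Num.Theory.
Import numFieldNormedType.Exports.

Local Open Scope classical_set_scope.
Local Open Scope ring_scope.

(** Nonnegativity of K would usually be read off the spectral theorem. It is derived here from
    resolvents alone: a negative value in the numerical range of (x - H)^-1, for x > 4d, is excluded
    by inverting at a second point of the resolvent set. The function w is not known to lie in l^2,
    so only finitely supported cutoffs of it enter the form, and K w = 0 is obtained pointwise, by a
    Cauchy-Schwarz argument against indicators of single sites. The exponent d/2 is critical in both
    directions. The bound u^2 = O(|n|^-d) keeps the cutoff error at N^d N^-d N^-2, whereas summing
    u^2 over radii gives the integral of dr / (r log_1 r ... log_s r), that is log_(s+1), which
    diverges. The explicit potential with s terms is compared with the weight for s + 1. Its
    logarithms leave a surplus of order (|n| log |n|)^-2, which absorbs the Taylor terms of order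
    |n|^-4; for the weight without logarithms this surplus vanishes. *)

Section RealSums.
Context {R : realType} {I : choiceType}.
Implicit Types (f g a b : I -> R).

(** * Unconditional sums of real families *)

Definition summ f : Prop := summable [set: I] (EFin \o f).

(* Only meaningful when [summ f]: otherwise [fine] may have turned an infinite
   part into 0. *)
Definition tsum f : R :=
  fine (\esum_(i in [set: I]) ((EFin \o f)^\+)%E i) -
  fine (\esum_(i in [set: I]) ((EFin \o f)^\-)%E i).

Lemma summ_le f g : (forall i, `|f i| <= g i) -> summ g -> summ f.
Proof.
move=> fg; apply: le_lt_trans; apply: le_esum => i _ /=.
by rewrite lee_fin (le_trans (fg i))// ler_norm.
Qed.

Lemma summD f g : summ f -> summ g -> summ (fun i => f i + g i).
Proof. by move=> sf sg; have := summableD sf sg. Qed.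

Lemma summN f : summ f -> summ (fun i => - f i).
Proof. by move=> sf; rewrite /summ; move: sf; rewrite /summ summableN. Qed.

Lemma summB f g : summ f -> summ g -> summ (fun i => f i - g i).
Proof. by move=> sf sg; have := summableB sf sg. Qed.

Lemma summ0 : summ (fun=> 0).
Proof. by rewrite /summ/summable esum1 ?ltry// => i _ /=; rewrite normr0. Qed.

Lemma summ_fin f (A : set I) : finite_set A -> (forall i, ~ A i -> f i = 0) ->
  summ f.
Proof.
move=> fA f0; rewrite /summ/summable.
have -> : (\esum_(x in [set: I]) `|(EFin \o f) x|%E =
          \esum_(x in A) `|(EFin \o f) x|%E)%E.
  rewrite [RHS]esum_mkcond; apply: eq_esum => i _.
  case: ifPn => // /negP; rewrite inE => /f0 /= ->.
  by rewrite normr0.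
by rewrite esum_fset// fsbig_finite//= sumEFin ltry.
Qed.

Lemma summ_sum (J : Type) (s : seq J) (F : J -> I -> R) :
  (forall j, summ (F j)) -> summ (fun i => \sum_(j <- s) F j i).
Proof.
move=> sF; elim: s => [|j s IH].
  by under eq_fun do rewrite big_nil; exact: summ0.
by under eq_fun do rewrite big_cons; exact: summD.
Qed.

Lemma esum_fin_num f : summ f -> (forall i, 0 <= f i) ->
  (\esum_(i in [set: I]) (f i)%:E \is a fin_num)%E.
Proof.
rewrite /summ summableE => sf f0.
by move: sf; under eq_esum do rewrite /= ger0_norm//.
Qed.

(** Any splitting into nonnegative summable families computes the sum, not only the one into
    positive and negative parts; additivity of [tsum] rests on this freedom. *)
Lemma tsum_diff a b : summ a -> summ b ->
  (forall i, 0 <= a i) -> (forall i, 0 <= b i) ->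
  tsum (fun i => a i - b i) =
  fine (\esum_(i in [set: I]) (a i)%:E) - fine (\esum_(i in [set: I]) (b i)%:E).
Proof.
move=> sa sb a0 b0; apply: EFin_inj.
have sab := summB sa sb.
have := esumB sa sb (fun i _ => a0 i) (fun i _ => b0 i).
rewrite [X in (X - _)%E](_ : _ =
  (\esum_(i in [set: I]) ((EFin \o (fun i => (a i - b i)%R))^\+)%E i)%E)//.
rewrite [X in (_ - X)%E](_ : _ =
  (\esum_(i in [set: I]) ((EFin \o (fun i => (a i - b i)%R))^\-)%E i)%E)//.
have h1 := summable_funepos sab; have h2 := summable_funeneg sab.
rewrite /tsum !EFinB !fineK ?esum_fin_num//.
- rewrite summableE in h2; move: h2.
  by under eq_esum do rewrite gee0_abs//.
- rewrite summableE in h1; move: h1.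
  by under eq_esum do rewrite gee0_abs//.
Qed.

Lemma tsum_esum f : summ f -> (forall i, 0 <= f i) ->
  tsum f = fine (\esum_(i in [set: I]) (f i)%:E).
Proof.
move=> sf f0; have := tsum_diff sf summ0 f0 (fun=> lexx 0).
rewrite (esum1 (a := fun=> 0%:E))// subr0 => <-.
by congr tsum; apply/funext => i; rewrite subr0.
Qed.

Lemma tsumB_pos a b : summ a -> summ b ->
  (forall i, 0 <= a i) -> (forall i, 0 <= b i) ->
  tsum (fun i => a i - b i) = tsum a - tsum b.
Proof. by move=> *; rewrite tsum_diff// !tsum_esum. Qed.

Lemma tsumD_pos a b : summ a -> summ b ->
  (forall i, 0 <= a i) -> (forall i, 0 <= b i) ->
  tsum (fun i => a i + b i) = tsum a + tsum b.
Proof.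
move=> sa sb a0 b0; rewrite !tsum_esum//; last 2 first.
- exact: summD.
- by move=> i; rewrite addr_ge0.
under eq_esum do rewrite EFinD.
rewrite esumD; try by move=> i _; rewrite lee_fin.
by rewrite fineD ?esum_fin_num.
Qed.

Let pos f i := Num.max (f i) 0.
Let neg f i := Num.max (- f i) 0.

Lemma pos_neg f i : f i = pos f i - neg f i.
Proof. by rewrite /pos/neg; case: (leP (f i) 0); case: (leP (- f i) 0); lra. Qed.

Lemma pos_ge0 f i : 0 <= pos f i. Proof. by rewrite le_max lexx orbT. Qed.
Lemma neg_ge0 f i : 0 <= neg f i. Proof. by rewrite le_max lexx orbT. Qed.

Lemma summ_norm f : summ f -> summ (fun i => `|f i|).
Proof.
by apply: le_lt_trans; apply: le_esum => i _ /=; rewrite normr_id.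
Qed.

Lemma summ_pos f : summ f -> summ (pos f).
Proof.
move=> /summ_norm; apply: summ_le => i; rewrite ger0_norm ?pos_ge0//.
by rewrite ge_max ler_norm normr_ge0.
Qed.

Lemma summ_neg f : summ f -> summ (neg f).
Proof.
move=> /summ_norm; apply: summ_le => i; rewrite ger0_norm ?neg_ge0//.
by rewrite ge_max -normrN ler_norm normr_ge0.
Qed.

Lemma tsumD f g : summ f -> summ g ->
  tsum (fun i => f i + g i) = tsum f + tsum g.
Proof.
move=> sf sg.
have -> : tsum (fun i => f i + g i) =
          tsum (fun i => (pos f i + pos g i) - (neg f i + neg g i)).
  by congr tsum; apply/funext => i; rewrite (pos_neg f) (pos_neg g); lra.
have sp := summ_pos; have sn := summ_neg.
have pp := pos_ge0; have nn := neg_ge0.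
rewrite tsumB_pos; try by move=> i; rewrite addr_ge0.
- rewrite !tsumD_pos; try by [exact: sp|exact: sn|].
  have e h : summ h -> tsum h = tsum (pos h) - tsum (neg h).
    move=> sh; rewrite -tsumB_pos; try by [exact: sp|exact: sn|].
    by congr tsum; apply/funext => i; exact: pos_neg.
  by rewrite (e f)// (e g)//; lra.
- by apply: summD; exact: sp.
- by apply: summD; exact: sn.
Qed.

Lemma tsum_ge0 f : (forall i, 0 <= f i) -> 0 <= tsum f.
Proof.
move=> f0; rewrite /tsum.
rewrite (eq_esum (b := EFin \o f)); last first.
  by move=> i _; rewrite funeposE/= max_l// lee_fin.
rewrite [X in _ - fine X]esum1; last first.
  by move=> i _; rewrite funenegE/= max_r// lee_fin oppr_le0.
by rewrite subr0 fine_ge0// esum_ge0// => i _; rewrite lee_fin.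
Qed.

Lemma tsum0 : tsum (fun=> 0) = 0.
Proof. by rewrite tsum_esum ?esum1//; exact: summ0. Qed.

Lemma tsumN f : summ f -> tsum (fun i => - f i) = - tsum f.
Proof.
move=> sf; apply/eqP; rewrite -addr_eq0 -tsumD//; last exact: summN.
by rewrite -[X in _ == X]tsum0; apply/eqP; congr tsum; apply/funext => i; rewrite addNr.
Qed.

Lemma tsumB f g : summ f -> summ g ->
  tsum (fun i => f i - g i) = tsum f - tsum g.
Proof. by move=> sf sg; rewrite tsumD ?tsumN//; exact: summN. Qed.

Lemma tsum_le f g : summ f -> summ g -> (forall i, f i <= g i) ->
  tsum f <= tsum g.
Proof.
move=> sf sg fg; rewrite -subr_ge0 -tsumB//; apply: tsum_ge0 => i.
by rewrite subr_ge0.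
Qed.

Lemma summZ c f : summ f -> summ (fun i => c * f i).
Proof.
rewrite /summ/summable => sf.
have -> : (\esum_(x in [set: I]) `|(EFin \o (fun i => (c * f i)%R)) x| =
  \esum_(x in [set: I]) ((`|c| * `|f x|)%:E))%E.
  by apply: eq_esum => i _ /=; rewrite normrM.
(* A natural number above |c| reduces scaling to repeated addition. *)
have [M cM] : exists M : nat, `|c| <= M%:R.
  by exists (Num.bound `|c|); apply/ltW/archi_boundP.
have : summ (fun i => M%:R * `|f i|).
  elim: M {cM} => [|M IH]; first by under eq_fun do rewrite mul0r; exact: summ0.
  under eq_fun do rewrite -natr1 mulrDl mul1r.
  by apply: summD => //; exact: summ_norm.
apply: le_lt_trans; apply: le_esum => i _ /=.
by rewrite lee_fin [leRHS]ger0_norm ?mulr_ge0// ler_wpM2r.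
Qed.

Lemma tsumZ c f : summ f -> tsum (fun i => c * f i) = c * tsum f.
Proof.
suff H (b : R) g : 0 <= b -> summ g -> (forall i, 0 <= g i) ->
    tsum (fun i => b * g i) = b * tsum g.
  have H2 (b : R) g : 0 <= b -> summ g -> tsum (fun i => b * g i) = b * tsum g.
    move=> b0 sg.
    have sp := summ_pos sg; have sn := summ_neg sg.
    have -> : tsum (fun i => b * g i) = tsum (fun i => b * pos g i - b * neg g i).
      by congr tsum; apply/funext => i; rewrite -mulrBr -pos_neg.
    have -> : tsum g = tsum (fun i => pos g i - neg g i).
      by congr tsum; apply/funext => i; rewrite -pos_neg.
    rewrite !tsumB//; try exact: summZ.
    by rewrite !H// ?mulrBr//; [exact: neg_ge0|exact: pos_ge0].
  move=> sf; have [c0|c0] := leP 0 c; first exact: H2.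
  have -> : tsum (fun i => c * f i) = tsum (fun i => - (- c * f i)).
    by congr tsum; apply/funext => i; rewrite mulNr opprK.
  rewrite tsumN; last exact: summZ.
  by rewrite H2// ?mulNr ?opprK// oppr_ge0 ltW.
move=> b0 sg g0; rewrite !tsum_esum//; last 2 first.
- exact: summZ.
- by move=> i; rewrite mulr_ge0.
have [->|bN0] := eqVneq b 0.
  by rewrite mul0r esum1// => i _; rewrite mul0r.
have bp : 0 < b by rewrite lt_neqAle eq_sym bN0.
(* Used with e = b and with e = b^-1, this single inequality gives equality. *)
have le_esumZ (e : R) h : 0 < e -> summ h -> (forall i, 0 <= h i) ->
    fine (\esum_(i in [set: I]) (e * h i)%:E) <=
    e * fine (\esum_(i in [set: I]) (h i)%:E).
  move=> e0 sh h0.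
  rewrite -lee_fin fineK; last first.
    by apply: esum_fin_num => [|i]; [exact: summZ|rewrite mulr_ge0// ltW].
  apply: ge_ereal_sup => /= _ [X [finX _] <-].
  rewrite fsbig_finite//= sumEFin -mulr_sumr lee_fin ler_pM2l//.
  rewrite -lee_fin fineK ?esum_fin_num//.
  by apply: esum_ge; exists X; [split|rewrite fsbig_finite//= sumEFin].
apply/eqP; rewrite eq_le le_esumZ//=.
have := le_esumZ b^-1 (fun i => b * g i).
rewrite invr_gt0 => /(_ bp (summZ _ sg) (fun i => mulr_ge0 b0 (g0 i))).
rewrite (eq_esum (b := EFin \o g)); last by move=> i _; rewrite mulKf.
by move=> h; rewrite -(ler_pM2l (x := b^-1)) ?invr_gt0// mulKf.
Qed.

Lemma tsum_sum (J : Type) (s : seq J) (F : J -> I -> R) :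
  (forall j, summ (F j)) ->
  tsum (fun i => \sum_(j <- s) F j i) = \sum_(j <- s) tsum (F j).
Proof.
move=> sF; elim: s => [|j s IH].
  by under eq_fun do rewrite big_nil; rewrite big_nil tsum0.
under eq_fun do rewrite big_cons.
by rewrite big_cons tsumD ?IH//; exact: summ_sum.
Qed.

Lemma summ_bij (s : I -> I) f : bijective s -> summ f -> summ (f \o s).
Proof.
move=> bs; rewrite /summ/summable => sf.
rewrite (_ : (\esum_(_ in _) _)%E = (\esum_(i in [set: I]) `|(f i)%:E|)%E)//.
by apply/esym/reindex_esum; rewrite setTT_bijective.
Qed.

Lemma tsum_bij (s : I -> I) f : bijective s -> tsum (f \o s) = tsum f.
Proof.
move=> bs; have sb : set_bij [set: I] [set: I] s by rewrite setTT_bijective.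
rewrite /tsum (reindex_esum _ _ _ ((EFin \o f)^\+)%E sb).
rewrite (reindex_esum _ _ _ ((EFin \o f)^\-)%E sb).
congr (fine _ - fine _); apply: eq_esum => i _.
- by rewrite !funeposE.
- by rewrite !funenegE.
Qed.

Lemma tsum_ge_term f i : summ f -> (forall k, 0 <= f k) -> f i <= tsum f.
Proof.
move=> sf f0; rewrite tsum_esum// -lee_fin fineK ?esum_fin_num//.
apply: esum_ge; exists [set i]; first by split.
by rewrite fsbig_set1.
Qed.

Lemma tsum_fset f (A : set I) : finite_set A -> (forall i, 0 <= f i) ->
  (forall i, ~ A i -> f i = 0) -> tsum f = \sum_(i \in A) f i.
Proof.
move=> fA f0 fA0; rewrite tsum_esum//; last exact: summ_fin fA0.
have -> : (\esum_(x in [set: I]) (f x)%:E = \esum_(x in A) (f x)%:E)%E.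
  rewrite [RHS]esum_mkcond; apply: eq_esum => i _.
  by case: ifPn => // /negP; rewrite inE => /fA0 ->.
rewrite esum_fset//; last by move=> i _; rewrite lee_fin.
by rewrite !fsbig_finite//= sumEFin.
Qed.

End RealSums.

(** * Real l^2: from resolvents to the numerical range *)

Section RealEll2.
Context {R : realType} {I : choiceType}.
Implicit Types (f g h k : I -> R) (D : (I -> R) -> Prop).

Definition l2 f : Prop := summ (fun i => f i ^+ 2).

Definition ip f g : R := tsum (fun i => f i * g i).

Lemma summ_mul f g : l2 f -> l2 g -> summ (fun i => f i * g i).
Proof.
move=> l2f l2g; apply: summ_le (summD l2f l2g) => i.
by rewrite ler_norml; have := sqr_ge0 (f i - g i); have := sqr_ge0 (f i + g i); nra.
Qed.

Lemma l2_le f g : (forall i, `|f i| <= `|g i|) -> l2 g -> l2 f.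
Proof.
move=> fg; apply: summ_le => i.
by rewrite normrX -[leRHS]real_normK ?num_real// lerXn2r ?nnegrE.
Qed.

Lemma l2D f g c : l2 f -> l2 g -> l2 (fun i => f i + c * g i).
Proof.
move=> l2f l2g.
apply: (summ_le _ (summD (summZ 2 l2f) (summZ (2 * c ^+ 2) l2g))) => i.
rewrite ger0_norm ?sqr_ge0//; have := sqr_ge0 (f i - c * g i); nra.
Qed.

Lemma l2Z f c : l2 f -> l2 (fun i => c * f i).
Proof.
by move=> /(summZ (c ^+ 2)); rewrite /l2; under [X in _ -> summ X]eq_fun do rewrite exprMn.
Qed.

Lemma l2_bij (s : I -> I) f : bijective s -> l2 f -> l2 (f \o s).
Proof. by move=> bs /(summ_bij bs). Qed.

Lemma l2_fin f (A : set I) : finite_set A -> (forall i, ~ A i -> f i = 0) ->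
  l2 f.
Proof. by move=> fA f0; apply: summ_fin fA _ => i /f0 ->; rewrite expr0n. Qed.

Lemma ipC f g : ip f g = ip g f.
Proof. by congr tsum; apply/funext => i; rewrite mulrC. Qed.

Lemma ipDr f g h c : l2 f -> l2 g -> l2 h ->
  ip f (fun i => g i + c * h i) = ip f g + c * ip f h.
Proof.
move=> l2f l2g l2h; rewrite /ip -tsumZ; last exact: summ_mul.
rewrite -tsumD; [|exact: summ_mul|by apply: summZ; exact: summ_mul].
by congr tsum; apply/funext => i; ring.
Qed.

Lemma ipDl f g h c : l2 f -> l2 g -> l2 h ->
  ip (fun i => g i + c * h i) f = ip g f + c * ip h f.
Proof. by move=> *; rewrite ipC ipDr// 2![ip f _]ipC. Qed.

Lemma ip_ge0 f : 0 <= ip f f.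
Proof. by apply: tsum_ge0 => i; rewrite -expr2 sqr_ge0. Qed.

Lemma ipZZ f c : l2 f -> ip (fun i => c * f i) (fun i => c * f i) = c ^+ 2 * ip f f.
Proof.
move=> l2f; rewrite /ip -tsumZ; last exact: summ_mul.
by congr tsum; apply/funext => i; ring.
Qed.

Lemma ip_quad f g f' g' c : l2 f -> l2 g -> l2 f' -> l2 g' ->
  ip (fun i => f i + c * g i) (fun i => f' i + c * g' i) =
  ip f f' + c * (ip f g' + ip g f') + c ^+ 2 * ip g g'.
Proof. by move=> *; rewrite ipDl ?ipDr//; [ring|exact: l2D]. Qed.

Lemma ip_le f g : l2 f -> l2 g -> ip f g <= (ip f f + ip g g) / 2.
Proof.
move=> l2f l2g; have := ip_ge0 (fun i => f i + -1 * g i).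
by rewrite ip_quad// [ip g f]ipC; lra.
Qed.

Lemma ip_ge f g : l2 f -> l2 g -> - ((ip f f + ip g g) / 2) <= ip f g.
Proof.
move=> l2f l2g; have := ip_ge0 (fun i => f i + 1 * g i).
by rewrite ip_quad// [ip g f]ipC; lra.
Qed.

Definition symmetric_op D (H : (I -> R) -> I -> R) : Prop :=
  [/\ forall c g h, D g -> D h -> D (fun n => g n + c * h n),
      forall g, D g -> l2 g /\ l2 (H g),
      forall c g h, D g -> D h ->
        H (fun n => g n + c * h n) = (fun n => H g n + c * H h n) &
      forall g h, D g -> D h -> ip g (H h) = ip (H g) h].

(** Real form of membership in the resolvent set, with x - H in place of H - x and with squared
    norms; injectivity is contained in the bound. *)
Definition resolvent_bound D (H : (I -> R) -> I -> R) (x : R) : Prop :=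
  (forall f, l2 f -> exists2 g, D g & forall n, x * g n - H g n = f n) /\
  exists2 c, 0 <= c & forall g, D g ->
    ip g g <= c * ip (fun n => x * g n - H g n) (fun n => x * g n - H g n).

(* With A = (x - H)^-1 and a the bottom of the numerical range of A: if a < 0,
   then A - a is nonnegative, and it is boundedly invertible because x - 1/a is
   in the resolvent set, so that a can be increased. *)
Lemma resolvent_form_ge0 D H l x : symmetric_op D H ->
  (forall y, l < y -> resolvent_bound D H y) -> l < x ->
  forall g, D g -> 0 <= ip g (fun n => x * g n - H g n).
Proof.
move=> [DD Dl2 HD Hsym] res lx.
pose T g := fun n => x * g n - H g n.
have Tl2 g : D g -> l2 (T g).
  move=> /Dl2[g2 Hg2]; rewrite /T.
  have -> : (fun n => x * g n - H g n) = (fun n => x * g n + -1 * H g n).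
    by apply/funext => n; ring.
  by apply: l2D => //; exact: l2Z.
have TD c g h : D g -> D h -> T (fun n => g n + c * h n) = (fun n => T g n + c * T h n).
  by move=> Dg Dh; apply/funext => n; rewrite /T HD//; ring.
have Tsym g h : D g -> D h -> ip g (T h) = ip (T g) h.
  move=> Dg Dh; have [g2 Hg2] := Dl2 _ Dg; have [h2 Hh2] := Dl2 _ Dh.
  have TE k : T k = (fun n => (fun n => x * k n) n + -1 * H k n).
    by apply/funext => n; rewrite /T; ring.
  rewrite !TE ipDr ?ipDl//; try exact: l2Z.
  by rewrite Hsym//; congr (_ + _); congr tsum; apply/funext => n; ring.
have [surj [c c0 cP]] := res _ lx.
have low g : D g -> - ((c + 1) / 2) * ip (T g) (T g) <= ip g (T g).
  move=> Dg; have [g2 _] := Dl2 _ Dg.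
  by have := ip_ge g2 (Tl2 _ Dg); have := cP _ Dg; rewrite -/(T g); lra.
apply: contrapT => /existsNP[g0 /not_implyP[Dg0 /negP]].
rewrite -/(T g0) -ltNge => g0lt.
pose S := [set a : R | forall g, D g -> a * ip (T g) (T g) <= ip g (T g)].
have S0 : S !=set0 by exists (- ((c + 1) / 2)).
have Tg0 : 0 < ip (T g0) (T g0).
  by rewrite lt_neqAle ip_ge0 eq_sym andbT; apply: contraTneq g0lt => e; have := low _ Dg0; rewrite e; lra.
have Sub g : D g -> 0 < ip (T g) (T g) -> ubound S (ip g (T g) / ip (T g) (T g)).
  by move=> Dg Tg a /(_ _ Dg) Sa; rewrite ler_pdivlMr.
pose a := sup S.
have aS : S a.
  move=> g Dg; have := ip_ge0 (T g); rewrite le_eqVlt => /orP[/eqP e|Tg].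
    by have := low _ Dg; rewrite -e; lra.
  by rewrite -ler_pdivlMr//; apply: ge_sup => //; exact: Sub.
have a_lt0 : a < 0.
  apply: (@le_lt_trans _ _ (ip g0 (T g0) / ip (T g0) (T g0))).
    by apply: ge_sup => //; exact: Sub.
  by rewrite pmulr_llt0// invr_gt0.
have a2 : 0 < a ^+ 2 by rewrite exprn_even_gt0//= lt_eqF.
have x1 : l < x - a^-1.
  by apply: lt_trans lx _; rewrite ltrDl oppr_gt0 invr_lt0.
have [_ [c1 c10 c1P]] := res _ x1.
(* [C] bounds the form of A - a from above (see [hh]), and [C1] bounds the squared norm of the
   inverse of A - a (see [q2]). *)
pose C := (c + 1) / 2 - a.
have C0 : 0 < C by rewrite /C; lra.
pose C1 := (2 * (c1 / a ^+ 2) + 2) / a ^+ 2.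
have C10 : 0 < C1.
  by rewrite divr_gt0//; have : 0 <= c1 / a ^+ 2 by [rewrite divr_ge0// ltW|]; lra.
have aN0 : a != 0 by rewrite lt_eqF.
suff : S (a + (C * C1)^-1).
  move=> Sa; have : a + (C * C1)^-1 <= a.
    apply: ub_le_sup => //; exists (ip g0 (T g0) / ip (T g0) (T g0)).
    exact: Sub.
  by rewrite gerDl leNgt invr_gt0 mulr_gt0.
move=> g Dg; have [g2 Hg2] := Dl2 _ Dg; have Tg2 := Tl2 _ Dg.
pose B := fun n => g n + - a * T g n.
have B2 : l2 B by exact: l2D.
have [h Dh hB] := surj _ B2.
have ThB : T h = B by apply/funext.
have [h2 _] := Dl2 _ Dh.
have hh : ip h B - a * ip B B <= C * ip B B.
  have := ip_le h2 B2; have := cP _ Dh; rewrite -/(T h) ThB /C.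
  by lra.
have cross : ip g B + ip h (T g) - 2 * a * ip (T g) B = 2 * ip B B.
  rewrite Tsym// ThB; have : ip B B = ip g B + - a * ip (T g) B.
    exact: ipDl.
  by rewrite [ip B g]ipC; lra.
(* The form of A - a is nonnegative at f - (A - a) f / C, where f = T g; expanding it gives (A -
   a)^2 <= C (A - a), which is [q1]. *)
have := aS _ (DD (- C^-1) _ _ Dg Dh); rewrite TD// ThB (ip_quad _ Tg2 B2 Tg2 B2) (ip_quad _ g2 h2 Tg2 B2) [ip B (T g)]ipC.
move=> q.
have q1 : ip B B / C <= ip g (T g) - a * ip (T g) (T g).
  have : C^-1 ^+ 2 * (ip h B - a * ip B B) <= C^-1 * ip B B.
    rewrite (_ : C^-1 * ip B B = C^-1 ^+ 2 * (C * ip B B)).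
      by rewrite ler_pM2l// exprn_gt0// invr_gt0.
    by field; rewrite gt_eqF.
  move: q cross; set iC := C^-1 => q cross hq.
  have cross' : iC * (ip g B + ip h (T g) - 2 * a * ip (T g) B) =
    iC * (2 * ip B B) by rewrite cross.
  move: hq q; rewrite sqrrN => hq q.
  move: hq q cross'; lra.
have q2 : ip (T g) (T g) <= C1 * ip B B.
  have gB : ip g g <= c1 / a ^+ 2 * ip B B.
    have := c1P _ Dg; congr (_ <= _).
    (* The identity (x - 1/a - H) g = - B / a is the reason for choosing x - 1/a as second resolvent
       point. *)
    rewrite (_ : (fun n => (x - a^-1) * g n - H g n) = (fun n => - a^-1 * B n)).
      by rewrite ipZZ// sqrrN exprVn; ring.
    by apply/funext => n; rewrite /B /T; field.
  have : a ^+ 2 * ip (T g) (T g) <= 2 * ip g g + 2 * ip B B.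
    rewrite -ipZZ// (_ : (fun i => a * T g i) = (fun i => g i + -1 * B i)).
      by rewrite ip_quad// [ip B g]ipC; have := ip_ge g2 B2; lra.
    by apply/funext => n; rewrite /B; ring.
  rewrite -ler_pdivlMl// => /le_trans; apply.
  rewrite /C1 mulrAC mulrC ler_pM2r ?invr_gt0//.
  lra.
rewrite mulrDl -lerBrDl; apply: le_trans q1.
by rewrite invfM -mulrA [leRHS]mulrC ler_pM2l ?invr_gt0// ler_pdivrMl.
Qed.

(** Limit x -> l in the preceding bound; the gap e / (1 + ip g g) makes the error at most e. *)
Lemma resolvent_form_le D H l : symmetric_op D H ->
  (forall y, l < y -> resolvent_bound D H y) ->
  forall g, D g -> ip g (H g) <= l * ip g g.
Proof.
move=> sH res g Dg; have [_ Dl2 _ _] := sH; have [g2 Hg2] := Dl2 _ Dg.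
apply/ler_addgt0Pr => e e0.
have q0 := ip_ge0 g.
have lx : l < l + e / (1 + ip g g) by rewrite ltrDl divr_gt0//; lra.
have := resolvent_form_ge0 sH res lx Dg.
rewrite (_ : (fun n => _) = fun n => (fun n => (l + e / (1 + ip g g)) * g n) n + -1 * H g n); last first.
  by apply/funext => n; ring.
rewrite ipDr//; last exact: l2Z.
rewrite (_ : ip g (fun n => _) = (l + e / (1 + ip g g)) * ip g g); last first.
  by rewrite /ip -tsumZ; [congr tsum; apply/funext => i; ring|exact: summ_mul].
have : e / (1 + ip g g) * ip g g <= e.
  by rewrite mulrAC ler_pdivrMr ?ler_pM2l//; lra.
lra.
Qed.

End RealEll2.

(** * The operator on real lattice functions *)

Section Lattice.
Context {R : realType} {d : nat}.
Local Notation Zd := 'rV[int]_d.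
Implicit Types (f g h : Zd -> R) (n m e : Zd) (V : Zd -> R).

(** The codomain is generic so that the same expression serves complex functions and their real
    parts. *)
Definition adj {W : nmodType} (f : Zd -> W) n : W :=
  \sum_(j < d) (f (n + delta j) + f (n - delta j)).

(* H_V on real functions. *)
Definition hop V f n : R := 2 * d%:R * f n - adj f n + V n * f n.

Definition hdom V f : Prop := l2 f /\ l2 (fun n => V n * f n).

Lemma deltaE (i j : 'I_d) : (delta i : Zd) 0 j = (i == j)%:R.
Proof. by rewrite mxE eqxx/= eq_sym. Qed.

Lemma enorm_sqr n : enorm n ^+ 2 = \sum_(j < d) (n 0 j)%:~R ^+ 2 :> R.
Proof. by rewrite sqr_sqrtr// sumr_ge0// => j _; rewrite sqr_ge0. Qed.

Lemma enorm_ge0 n : 0 <= enorm n :> R.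
Proof. exact: sqrtr_ge0. Qed.

(** Neighbours are indexed by a direction and a sign, hence by a finite type that can be
    enumerated. *)
Definition step (p : 'I_d * bool) : Zd := if p.2 then delta p.1 else - delta p.1.

Lemma step_inj : injective step.
Proof.
move=> [i b] [j c] /matrixP /(_ 0 i); rewrite /step/=.
have [<-|ij] := eqVneq i j; case: b; case: c => //;
  by rewrite ?mxE ?eqxx/= ?(negbTE ij) => /eqP.
Qed.

Lemma enorm_eq1 n : (enorm n = 1 :> R) <-> exists p, n = step p.
Proof.
split=> [n1|[[j b] ->]]; last first.
  rewrite /enorm (bigD1 j)//= big1 ?addr0 => [|i ij].
    by rewrite /step/=; case: b; rewrite ?mxE ?eqxx/= ?mulrNz ?sqrrN expr1n sqrtr1.
  rewrite /step/=; case: b; rewrite ?mxE ?eqxx/= (negbTE ij) ?oppr0.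
    by rewrite expr0n.
  by rewrite expr0n.
(* The norm equation is moved to the integers, where a sum of squares equal to 1 leaves a single
   nonzero coordinate, 1 or -1. *)
have {n1} : \sum_(j < d) (n 0 j) ^+ 2 = 1.
  have : (\sum_(j < d) (n 0 j) ^+ 2)%:~R = 1 :> R.
    transitivity (enorm n ^+ 2 : R); last by rewrite n1 expr1n.
    rewrite enorm_sqr rmorph_sum/=.
    by apply: eq_bigr => j _; rewrite rmorphXn.
  by move=> h; apply: (@intr_inj R); rewrite h.
move=> n1; have /existsP[j nj] : [exists j, n 0 j != 0].
  apply: contra_eqT n1 => /existsPn nj; rewrite big1// => j _.
  by have := nj j; rewrite negbK => /eqP ->.
move: n1; rewrite (bigD1 j)//= => n1.
have sq i : 0 <= n 0 i ^+ 2 by exact: sqr_ge0.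
have nj1 : 1 <= n 0 j ^+ 2 by rewrite -gtz0_ge1 lt_neqAle eq_sym sqrf_eq0 nj sq.
have rest : \sum_(i < d | i != j) n 0 i ^+ 2 = 0.
  have : 0 <= \sum_(i < d | i != j) n 0 i ^+ 2 by apply: sumr_ge0 => i _.
  move=> h; apply/eqP; rewrite eq_le h andbT.
  by rewrite -(lerD2l (n 0 j ^+ 2)) n1 addr0.
have n0 i : i != j -> n 0 i = 0.
  move=> ij; move/eqP: rest; rewrite psumr_eq0// => /allP/(_ i).
  by rewrite mem_index_enum ij sqrf_eq0 => /(_ isT)/eqP.
have /orP[/eqP e|/eqP e] : (n 0 j == 1) || (n 0 j == -1).
- by rewrite -eqf_sqr expr1n -n1 rest addr0.
- exists (j, true); apply/rowP => i; rewrite /step/= deltaE.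
  by case: eqVneq => [<-//|ji]; rewrite n0// eq_sym.
- exists (j, false); apply/rowP => i; rewrite /step/= mxE deltaE.
  by case: eqVneq => [<-//|ji]; rewrite n0 ?oppr0// eq_sym.
Qed.

Lemma neg_laplacianE (psi : Zd -> R[i]) n :
  neg_laplacian psi n = 2 * d%:R * psi n - adj psi n.
Proof.
pose s := [seq n + step p | p <- enum {: 'I_d * bool}].
have -> : neg_laplacian psi n = \sum_(m <- s) (psi n - psi m).
  rewrite fsbig_seq; last first.
    by rewrite map_inj_uniq ?enum_uniq// => p q /addrI/step_inj.
  apply: eq_fsbigl; apply/seteqP; split=> m /=.
    move=> /enorm_eq1[p mp]; apply/mapP; exists p; first by rewrite mem_enum.
    by rewrite -mp addrC subrK.
  by move=> /mapP[p _ ->]; apply/enorm_eq1; exists p; rewrite addrC addKr.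
rewrite big_map big_enum/= -(pair_bigA _ (fun i b => psi n - psi (n + step (i, b))))/=.
rewrite (eq_bigr (fun i => 2 * psi n - (psi (n + delta i) + psi (n - delta i)))).
  by rewrite sumrB sumr_const card_ord /adj -mulr_natr; congr (_ - _); ring.
by move=> i _; rewrite big_bool/= /step/=; ring.
Qed.

Lemma l2_sum (J : Type) (s : seq J) (F : J -> Zd -> R) :
  (forall j, l2 (F j)) -> l2 (fun n => \sum_(j <- s) F j n).
Proof.
move=> lF; elim: s => [|j s IH].
  under eq_fun do rewrite big_nil.
  by rewrite /l2; under eq_fun do rewrite expr0n; exact: summ0.
under eq_fun do rewrite big_cons -[X in _ + X]mul1r.
exact: l2D.
Qed.

Lemma shift_bij e : bijective (fun n => n + e).
Proof. by exists (fun n => n - e) => n; rewrite ?addrK ?subrK. Qed.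

Lemma l2_shift f e : l2 f -> l2 (fun n => f (n + e)).
Proof. by move=> /(l2_bij (shift_bij e)). Qed.

Lemma l2_adj f : l2 f -> l2 (adj f).
Proof.
move=> l2f; apply: l2_sum => j.
rewrite (_ : (fun _ => _) = (fun n => f (n + delta j) + 1 * f (n - delta j))).
  by apply: l2D; exact: l2_shift.
by apply/funext => n; rewrite mul1r.
Qed.

(** Shifting the index in the backward terms writes the sum over forward edges only, where
    exchanging f and g merely swaps the two terms. Only products are assumed summable, because
    [cutoff_form] takes for g a function that need not be in l^2. *)
Lemma ip_adj f g : (forall e, summ (fun n => f n * g (n + e))) ->
  ip f (adj g) =
  \sum_(j < d) (tsum (fun n => f n * g (n + delta j)) +
                tsum (fun n => f (n + delta j) * g n)).
Proof.
move=> s1; rewrite /ip.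
have sD e : summ (fun n => f n * g (n + e) + f n * g (n - e)).
  by apply: summD; exact: s1.
transitivity (tsum (fun n => \sum_(j < d) (f n * g (n + delta j) + f n * g (n - delta j)))).
  congr tsum; apply/funext => n; rewrite mulr_sumr.
  by apply: eq_bigr => j _; rewrite mulrDr.
rewrite tsum_sum//; apply: eq_bigr => j _.
rewrite tsumD//; congr (_ + _).
rewrite -[LHS](tsum_bij _ (shift_bij (delta j))); congr tsum.
by apply/funext => n /=; rewrite addrK.
Qed.

Lemma adjD f g c n : adj (fun n => f n + c * g n) n = adj f n + c * adj g n.
Proof.
by rewrite /adj mulr_sumr -big_split/=; apply: eq_bigr => j _; ring.
Qed.

Lemma hop_symmetric V : symmetric_op (hdom V) (hop V).
Proof.
split.
- move=> c g h [g2 Vg2] [h2 Vh2]; split; first exact: l2D.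
  rewrite (_ : (fun n => _) = (fun n => V n * g n + c * (V n * h n))).
    exact: l2D.
  by apply/funext => n; ring.
- move=> g [g2 Vg2]; split=> //; rewrite (_ : hop V g =
    fun n => (2 * d%:R * g n + -1 * adj g n) + 1 * (V n * g n)).
    by apply: l2D => //; apply: l2D; [exact: l2Z|exact: l2_adj].
  by apply/funext => n; rewrite /hop; ring.
- by move=> c g h _ _; apply/funext => n; rewrite /hop adjD; ring.
- move=> g h [g2 Vg2] [h2 Vh2].
  have E f f' : hdom V f -> hdom V f' -> ip f (hop V f') =
      ip f (fun n => 2 * d%:R * f' n + 1 * (V n * f' n)) + -1 * ip f (adj f').
    move=> [f2 Vf2] [f'2 Vf'2].
    rewrite -ipDr//; [|by apply: l2D => //; exact: l2Z|exact: l2_adj].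
    by congr ip; apply/funext => n; rewrite /hop; ring.
  rewrite [RHS]ipC !E// !ip_adj; try by move=> e; apply: summ_mul => //; exact: l2_shift.
  congr (_ + _ * _).
    by congr tsum; apply/funext => n; ring.
  apply: eq_bigr => j _; rewrite addrC; congr (_ + _);
    by congr tsum; apply/funext => n; rewrite mulrC.
Qed.

(** * Reduction of the complex operator to real functions *)

Local Notation emb f := (fun n => ((f n)%:C)%C).

Lemma normc_real (x : R) : Normc.normc (x%:C)%C = `|x|.
Proof. by rewrite /Normc.normc/= expr0n/= addr0 sqrtr_sqr. Qed.

Lemma ell2_emb f : ell2 (emb f) <-> l2 f.
Proof.
rewrite /ell2/l2/summ; rewrite (_ : [set psi | _] (emb f) =
  summable [set: Zd] (fun n => (Normc.normc ((f n)%:C)%C ^+ 2)%:E))//.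
suff -> : (fun n => (Normc.normc ((f n)%:C)%C ^+ 2)%:E) = EFin \o (fun n => f n ^+ 2) by [].
by apply/funext => n; rewrite normc_real real_normK ?num_real.
Qed.

Lemma ell2_norm_emb f : l2 f -> ell2_norm (emb f) ^+ 2 = ip f f.
Proof.
move=> l2f; rewrite /ell2_norm sqr_sqrtr; last first.
  by apply/fine_ge0/esum_ge0 => i _; rewrite lee_fin sqr_ge0.
rewrite (eq_esum (b := fun n => (f n ^+ 2)%:E)); last first.
  by move=> n _; rewrite normc_real real_normK ?num_real.
rewrite -tsum_esum//; last by move=> i; rewrite sqr_ge0.
Qed.

(** Common interface for [Re] and [Im]; both are wanted, since an eigenfunction may have vanishing
    real part. *)
Definition real_part (r : R[i] -> R) : Prop :=
  [/\ forall x y, r (x + y) = r x + r y,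
      forall a x, r ((a%:C)%C * x) = a * r x &
      forall x, `|r x| <= Normc.normc x].

Lemma real_part_Re : real_part (@complex.Re R).
Proof.
split=> [[a b] [a' b']|a [b c]|[a b]]//=; first by rewrite mul0r subr0.
by rewrite -sqrtr_sqr ler_wsqrtr// lerDl sqr_ge0.
Qed.

Lemma real_part_Im : real_part (@complex.Im R).
Proof.
split=> [[a b] [a' b']|a [b c]|[a b]]//=; first by rewrite mul0r addr0.
by rewrite -sqrtr_sqr ler_wsqrtr// lerDr sqr_ge0.
Qed.

Section RealPart.
Context (r : R[i] -> R) (rP : real_part r).

Lemma real_partN x : r (- x) = - r x.
Proof.
have [_ rZ _] := rP; have := rZ (-1) x.
by rewrite rmorphN1 !mulN1r.
Qed.

Lemma real_part_sum (J : Type) (s : seq J) (F : J -> R[i]) :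
  r (\sum_(j <- s) F j) = \sum_(j <- s) r (F j).
Proof.
have [rD rZ _] := rP; elim: s => [|j s IH]; last by rewrite !big_cons rD IH.
by rewrite !big_nil; have := rZ 0 0; rewrite mulr0 mul0r.
Qed.

Lemma real_part_hop V (psi : Zd -> R[i]) n :
  r (op_act (schrodinger V) psi n) = hop V (fun n => r (psi n)) n.
Proof.
have [rD rZ _] := rP.
rewrite /= neg_laplacianE rD rD real_partN /hop rZ; congr (_ - _ + _).
  rewrite (_ : 2 * d%:R * psi n = ((2 * d%:R)%:C)%C * psi n) ?rZ//.
  by rewrite rmorphM !rmorph_nat.
by rewrite real_part_sum; apply: eq_bigr => j _; rewrite rD.
Qed.

Lemma real_part_l2 (psi : Zd -> R[i]) : ell2 psi -> l2 (fun n => r (psi n)).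
Proof.
have [_ _ rN] := rP; apply: le_lt_trans; apply: le_esum => n _ /=.
by rewrite lee_fin !normrX lerXn2r ?nnegrE// (le_trans (rN _))// ler_norm.
Qed.

Lemma real_part_dom V (psi : Zd -> R[i]) :
  op_dom (schrodinger V) psi -> hdom V (fun n => r (psi n)).
Proof.
have [_ rZ _] := rP; move=> [/real_part_l2 h1 /real_part_l2 h2]; split=> //.
by move: h2; rewrite /potential_op; under eq_fun do rewrite rZ.
Qed.

End RealPart.

Lemma hop_emb V f n : op_act (schrodinger V) (emb f) n = ((hop V f n)%:C)%C.
Proof.
rewrite /= neg_laplacianE /potential_op /hop !rmorphD rmorphN !rmorphM/=.
rewrite !rmorph_nat rmorph_sum/=; congr (_ - _ + _).
by apply: eq_bigr => j _; rewrite rmorphD.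
Qed.

Lemma resolvent_real V (x : R) : resolvent_set (schrodinger V) (x%:C)%C ->
  resolvent_bound (hdom V) (hop V) x.
Proof.
move=> [[_ _ surj] [c cP]]; have [HD Hl2 _ _] := hop_symmetric V.
have reP := real_part_Re; split.
  move=> f l2f; have [psi psiD psif] := surj _ ((ell2_emb f).2 l2f).
  have := real_part_dom reP psiD; set g := (fun n => complex.Re (psi n)) => Dg.
  (* [shifted] is H - x while [resolvent_bound] inverts x - H, so the preimage is - g. It is written
     g - 2 g because closure of the domain is stated for combinations g + c h. *)
  have Dg' := HD (- 2) _ _ Dg Dg.
  exists (fun n => g n + -2 * g n) => // n.
  have := congr1 (fun F => complex.Re (F n)) psif; rewrite /shifted.
  have [rD rZ _] := reP; rewrite rD (real_partN reP) rZ (real_part_hop reP) -/g.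
  have [_ _ HZ _] := hop_symmetric V.
  by rewrite HZ//= => <-; ring.
exists (c ^+ 2); first exact: sqr_ge0.
move=> g Dg; have [g2 Hg2] := Hl2 _ Dg.
have Dg' : op_dom (schrodinger V) (emb g).
  case: Dg => _ Vg2; split; first exact: (ell2_emb g).2.
  have := (ell2_emb _).2 Vg2; congr ell2; apply/funext => n.
  by rewrite /potential_op rmorphM.
have := cP _ Dg'.
have -> : shifted (schrodinger V) (x%:C)%C (emb g) = emb (fun n => - (x * g n - hop V g n)).
  by apply/funext => n; rewrite /shifted hop_emb opprB rmorphB rmorphM.
have Tg2 : l2 (fun n => - (x * g n - hop V g n)).
  rewrite (_ : (fun n => _) = (fun n => hop V g n + - x * g n)); first exact: l2D.
  by apply/funext => n; ring.
move=> le; have : ell2_norm (emb g) ^+ 2 <= (c * ell2_norm (emb (fun n => - (x * g n - hop V g n)))) ^+ 2.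
  by rewrite lerXn2r// nnegrE ?sqrtr_ge0// (le_trans _ le)// sqrtr_ge0.
rewrite exprMn !ell2_norm_emb//; congr (_ <= _ * _).
by congr tsum; apply/funext => n; rewrite mulrNN.
Qed.

Lemma hop_le V : (4 * d%:R : R)%:E = sup_spectrum (schrodinger V) ->
  forall g, hdom V g -> ip g (hop V g) <= 4 * d%:R * ip g g.
Proof.
move=> supE; apply: resolvent_form_le; first exact: hop_symmetric.
move=> y ly; apply: resolvent_real; apply: contrapT => yN.
have : (y%:E <= sup_spectrum (schrodinger V))%E.
  by apply: ereal_sup_ubound; exists y.
by rewrite -supE lee_fin leNgt ly.
Qed.

End Lattice.

(** * Existence and positivity of the ground state *)

Section GroundState.
Context {R : realType} {d : nat}.
Local Notation Zd := 'rV[int]_d.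
Implicit Types (f g h u w chi phi : Zd -> R) (n m e : Zd) (V W : Zd -> R).

Definition checker n : R := (-1) ^ (\sum_(j < d) n 0 j).

Lemma checker_step n p : checker (n + step p) = - checker n.
Proof.
rewrite /checker (_ : \sum_(j < d) (n + step p) 0 j =
  \sum_(j < d) n 0 j + (if p.2 then 1 else -1)); last first.
  rewrite (eq_bigr (fun j => n 0 j + step p 0 j)) => [|j _]; last by rewrite mxE.
  rewrite big_split/=; congr (_ + _).
  case: p => j b; rewrite (bigD1 j)//= big1 ?addr0 => [|i ij].
    by rewrite /step; case: b; rewrite ?mxE ?eqxx.
  by rewrite /step; case: b; rewrite ?mxE ?eqxx/= (negbTE ij).
by rewrite expfzDr ?oppr_eq0 ?oner_eq0//; case: p.2; rewrite ?expr1z ?exprN1 ?invrN1 mulrN1.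
Qed.

Lemma checker_sqr n : checker n ^+ 2 = 1.
Proof.
by rewrite /checker; case: (\sum_(j < d) _) => k;
  rewrite /exprz ?exprVn sqrr_sign ?invr1.
Qed.

Lemma checker_hop V f n :
  hop V (fun m => checker m * f m) n =
  checker n * (4 * d%:R * f n - hop (fun m => - V m) f n).
Proof.
rewrite /hop (_ : adj _ n = - (checker n * adj f n)); first by ring.
rewrite /adj mulr_sumr -sumrN; apply: eq_bigr => j _.
have := checker_step n (j, true); have := checker_step n (j, false).
by rewrite /step/= => -> ->; ring.
Qed.

Lemma hdomN V f : hdom V f <-> hdom (fun n => - V n) f.
Proof.
by split=> -[f2 Vf]; split=> //; move: Vf; rewrite /l2;
  congr summ; apply/funext => n; rewrite mulNr sqrrN.
Qed.

Lemma checker_dom V f : hdom V f -> hdom V (fun n => checker n * f n).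
Proof.
by move=> [f2 Vf]; split; [move: f2|move: Vf]; rewrite /l2; congr summ;
  apply/funext => n; rewrite !exprMn checker_sqr ?mul1r.
Qed.

Lemma checker_form V : (forall g, hdom V g -> ip g (hop V g) <= 4 * d%:R * ip g g) ->
  forall g, hdom (fun n => - V n) g -> 0 <= ip g (hop (fun n => - V n) g).
Proof.
move=> le g NDg; have Dg : hdom V g := (hdomN V g).2 NDg.
have := le _ (checker_dom Dg).
have [_ Dl2 _ _] := hop_symmetric (fun n => - V n).
have [g2 Hg2] := Dl2 _ NDg.
rewrite (_ : ip _ (hop V _) = 4 * d%:R * ip g g + -1 * ip g (hop (fun n => - V n) g)).
  rewrite (_ : ip (fun n => checker n * g n) (fun n => checker n * g n) = ip g g).
    by lra.
  by congr tsum; apply/funext => n; rewrite mulrACA -expr2 checker_sqr mul1r.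
rewrite (_ : 4 * d%:R * ip g g = ip g (fun n => 4 * d%:R * g n)).
  rewrite -ipDr//; last exact: l2Z.
  congr tsum; apply/funext => n; rewrite checker_hop mulrACA -expr2 checker_sqr.
  by ring.
by rewrite /ip -tsumZ; [congr tsum; apply/funext => n; ring|exact: summ_mul].
Qed.

Definition nonneg_form W : Prop := forall g, hdom W g -> 0 <= ip g (hop W g).

Lemma hdom_fin W f (A : set Zd) : finite_set A -> (forall n, ~ A n -> f n = 0) ->
  hdom W f.
Proof. by move=> fA f0; split; apply: l2_fin fA _ => n /f0 ->; rewrite ?mulr0. Qed.

(** Cauchy-Schwarz for the form, against the indicator of n: the square of [hop W h n] is at most q
    times the form at h, with q the form value of the indicator. Only approximate minimizers h with
    a prescribed value of [hop W h n] are required, so a limit function need not belong to the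
    domain. *)
Lemma form_kernel W n x : nonneg_form W ->
  (forall eps, 0 < eps ->
    exists h, [/\ hdom W h, ip h (hop W h) <= eps & hop W h n = x]) -> x = 0.
Proof.
move=> W0 happ; have [DD Dl2 HD Hsym] := hop_symmetric W.
pose g m : R := (m == n)%:R.
have Dg : hdom W g.
  by apply: (@hdom_fin _ _ [set n]) => // m /= /eqP/negbTE mn; rewrite /g mn.
have ipg f : ip g f = f n.
  have E : (fun m => g m * f m) = (fun m => f n * g m).
    by apply/funext => m; rewrite /g; case: eqVneq => [->|]; rewrite ?mulr1 ?mulr0 ?mul1r ?mul0r.
  have gf m : ~ [set n] m -> g m = 0 by move=> /eqP/negbTE mn; rewrite /g mn.
  rewrite /ip E tsumZ; last by apply: summ_fin gf; exact: finite_set1.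
  by rewrite (tsum_fset _ _ gf)//= ?fsbig_set1 /g ?eqxx ?mulr1// => m; rewrite ler0n.
have [g2 Hg2] := Dl2 _ Dg.
set q := ip g (hop W g); have q0 : 0 <= q by exact: W0.
have H eps t : 0 < eps -> 0 <= eps + 2 * t * x + t ^+ 2 * q.
  move=> /happ[h [Dh he hx]]; have [h2 Hh2] := Dl2 _ Dh.
  have := W0 _ (DD t _ _ Dh Dg); rewrite HD// ip_quad// (Hsym h g)// [ip (hop W h) g]ipC !ipg hx.
  have -> : hop W g n = q by rewrite /q ipg.
  by move: he; lra.
apply: contrapT => /eqP xN0.
have x2 : 0 < x ^+ 2 by rewrite exprn_even_gt0.
have q1 : 0 < q + 1 by lra.
(* The value t = - x / (q + 1) minimizes 2 t x + t^2 (q + 1), where q + 1 > 0 even if q = 0; eps is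
   half of the gain x^2 / (q + 1). *)
have := H (x ^+ 2 / (q + 1) / 2) (- x / (q + 1)).
rewrite !divr_gt0// => /(_ isT); rewrite leNgt => /negP; apply.
rewrite (_ : _ + _ + _ = x ^+ 2 / (q + 1) ^+ 2 * (- (q + 1) / 2 - 1)).
  by rewrite pmulr_rlt0; [lra|rewrite divr_gt0// exprn_gt0].
by field; rewrite gt_eqF.
Qed.

(** At a zero of f the equation says that the sum of f over the neighbours vanishes, and its terms
    are nonnegative; the whole lattice is then reached along coordinate lines. *)
Lemma zero_propagates W f n0 : (forall n, 0 <= f n) -> (forall n, hop W f n = 0) ->
  f n0 = 0 -> forall n, f n = 0.
Proof.
move=> f0 Hf fn0.
have nb n : f n = 0 -> forall p, f (n + step p) = 0.
  move=> fn [j b]; have := Hf n; rewrite /hop fn !mulr0 sub0r addr0 => /eqP.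
  rewrite oppr_eq0 psumr_eq0 => [/allP/(_ j)|i _]; last by rewrite addr_ge0.
  rewrite mem_index_enum => /(_ isT)/=; rewrite paddr_eq0// => /andP[/eqP h1 /eqP h2].
  by rewrite /step; case: b.
have line (j : 'I_d) (k : int) n : f n = 0 -> f (n + delta j *~ k) = 0.
  have pos (b : bool) (l : nat) : f n = 0 -> f (n + step (j, b) *+ l) = 0.
    by move=> fn; elim: l => [|l IH]; rewrite ?addr0// mulrSr addrA nb.
  move=> fn; case: k => l; first by rewrite -pmulrn (pos true).
  by have := pos false l.+1 fn; rewrite NegzE mulrNz /step/= mulNrn pmulrn.
move=> n; rewrite -[n](subrK n0) addrC.
have -> : n - n0 = \sum_(j < d) delta j *~ (n - n0) 0 j.
  rewrite {1}[n - n0]row_sum_delta; apply: eq_bigr => j _.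
  by rewrite -scaler_int intz.
set c := fun j => (n - n0) 0 j.
elim: (index_enum _) => [|j s IH]; first by rewrite big_nil addr0.
by rewrite big_cons addrA addrAC line.
Qed.

(** Passing to |f| keeps the diagonal terms and can only increase the hopping term, so the form at
    |f| is at most the form at f, which is 0; [form_kernel] turns this into the equation for |f|. *)
Lemma ground_state W f : nonneg_form W -> hdom W f -> (forall n, hop W f n = 0) ->
  f <> (fun=> 0) ->
  exists phi, [/\ l2 phi, forall n, 0 < phi n & forall n, hop W phi n = 0].
Proof.
move=> W0 [f2 Wf2] Hf fN0; pose phi n := `|f n|.
have phi2 : l2 phi by apply: l2_le f2 => n; rewrite /phi normr_id.
have Dphi : hdom W phi.
  by split=> //; apply: l2_le Wf2 => n; rewrite /phi !normrM normr_id.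
have Hphi n : hop W phi n = 0.
  apply: form_kernel (W0) _ => eps eps0; exists phi; split => //.
  have [_ /(_ _ Dphi)[_ Hphi2] _ _] := hop_symmetric W.
  apply: (@le_trans _ _ 0); last exact: ltW.
  rewrite -[leRHS](@tsum0 R Zd); apply: tsum_le; [exact: summ_mul|exact: summ0|].
  move=> m; have : f m * hop W f m = 0 by rewrite Hf mulr0.
  rewrite /hop /phi mulrDr mulrBr => fm.
  have : f m * adj f m <= `|f m| * adj phi m.
    apply: (le_trans (ler_norm _)); rewrite normrM ler_wpM2l//.
    apply: (le_trans (ler_norm_sum _ _ _)); apply: ler_sum => j _.
    exact: ler_normD.
  have : `|f m| * (2 * d%:R * `|f m|) = f m * (2 * d%:R * f m).
    by rewrite mulrCA -normrM ger0_norm -?expr2 ?sqr_ge0//; ring.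
  have : `|f m| * (W m * `|f m|) = f m * (W m * f m).
    by rewrite mulrCA -normrM ger0_norm -?expr2 ?sqr_ge0//; ring.
  rewrite -/(phi) mulrDr mulrBr; lra.
exists phi; split=> // n; rewrite lt_neqAle normr_ge0 andbT eq_sym.
apply: contra_not_neq fN0 => phin; apply/funext => m; apply/eqP; rewrite -normr_eq0.
by apply/eqP/(zero_propagates (fun n => normr_ge0 (f n)) Hphi phin).
Qed.

(** * Norms of neighbours and counting in boxes *)

Lemma enormD n j : enorm (n + delta j) ^+ 2 = enorm n ^+ 2 + (1 + 2 * (n 0 j)%:~R) :> R.
Proof.
rewrite !enorm_sqr (bigD1 j)//= [in RHS](bigD1 j)//= (eq_bigr (fun i => (n 0 i)%:~R ^+ 2)).
  by rewrite !mxE !eqxx intrD/=; ring.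
by move=> i ij; rewrite !mxE eqxx/= (negbTE ij) addr0.
Qed.

Lemma enormB n j : enorm (n - delta j) ^+ 2 = enorm n ^+ 2 + (1 - 2 * (n 0 j)%:~R) :> R.
Proof.
rewrite !enorm_sqr (bigD1 j)//= [in RHS](bigD1 j)//= (eq_bigr (fun i => (n 0 i)%:~R ^+ 2)).
  by rewrite !mxE !eqxx intrB/=; ring.
by move=> i ij; rewrite !mxE eqxx/= (negbTE ij) subr0.
Qed.

Lemma coord_le n j : `|(n 0 j)%:~R| <= enorm n :> R.
Proof.
rewrite -(@ler_pXn2r _ 2) ?nnegrE ?enorm_ge0// real_normK ?num_real// enorm_sqr.
by rewrite (bigD1 j)//= lerDl sumr_ge0// => i _; rewrite sqr_ge0.
Qed.

Lemma enorm_step_le n p : enorm (n + step p) <= enorm n + 1 :> R.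
Proof.
have e0 := enorm_ge0 (R := R) n.
rewrite -(@ler_pXn2r _ 2) ?nnegrE ?enorm_ge0//; last by lra.
case: p => j b; have := coord_le n j; rewrite ler_norml => /andP[h1 h2].
rewrite /step/=; case: b; rewrite ?enormD ?enormB; nra.
Qed.

Lemma enorm_step_ge n p : enorm n - 1 <= enorm (n + step p) :> R.
Proof.
rewrite lerBlDr; case: p => j b.
have := enorm_step_le (n + step (j, b)) (j, ~~ b).
by rewrite /step; case: b => /=; rewrite ?addrK ?subrK.
Qed.

(** Given as an injective image of a type of finite functions, which yields both finiteness and the
    count (2 M + 1)^d used in [tsum_box]. *)
Definition box (M : nat) : set Zd :=
  [set (\row_j ((b j : nat)%:Z - M%:Z) : Zd) | b in [set: {ffun 'I_d -> 'I_(2 * M).+1}]].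

Lemma box_finite M : finite_set (box M).
Proof. by apply: finite_image; exact: finite_finset. Qed.

Lemma enorm_box M n : enorm n <= M%:R :> R -> box M n.
Proof.
move=> nM.
have nj j : `|n 0 j| <= M%:Z.
  have := le_trans (coord_le n j) nM; rewrite -intr_norm.
  by rewrite -[X in _ <= X]/((M%:Z)%:~R) ler_int.
exists [ffun j => inord (absz (n 0 j + M%:Z))] => //.
apply/rowP => j; rewrite !mxE ffunE inordK; have := nj j; lia.
Qed.

Lemma tsum_box M f C : (forall n, 0 <= f n) -> (forall n, ~ box M n -> f n = 0) ->
  (forall n, f n <= C) -> tsum f <= (2 * M%:R + 1) ^+ d * C.
Proof.
move=> f0 fout fC; have fin := box_finite M.
rewrite (tsum_fset fin f0 fout) /box fsbig_image; last first.
  move=> b b' _ _ /rowP e; apply/ffunP => j; apply/val_inj.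
  by have := e j; rewrite !mxE => /addIr[].
rewrite (_ : [set: _] = [set` index_enum {ffun 'I_d -> 'I_(2 * M).+1}]); last first.
  by apply/seteqP; split=> b //= _; rewrite mem_index_enum.
rewrite -fsbig_seq ?index_enum_uniq//.
apply: le_trans (ler_sum _ (fun b _ => fC _)) _.
by rewrite sumr_const card_ffun !card_ord -[leLHS]mulr_natl natrX -addn1 natrD natrM.
Qed.

Lemma ball_finite (r : R) : finite_set [set n : Zd | enorm n <= r].
Proof.
apply: sub_finite_set (box_finite (Num.bound `|r|)) => n /= nr; apply: enorm_box.
apply: (le_trans nr); apply: (le_trans (ler_norm _)).
exact/ltW/archi_boundP.
Qed.

(** * Cutoffs and comparison with a subsolution *)

Lemma small_multiple phi u (A : set Zd) : finite_set A -> (forall n, 0 < phi n) ->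
  exists2 c, 0 < c & forall n, A n -> c * u n <= phi n.
Proof.
move=> fA phi0; pose f n := if n \in A then `|u n| / phi n else 0.
have f0 n : 0 <= f n by rewrite /f; case: ifP => // _; rewrite divr_ge0// ltW.
have sf : summ f by apply: summ_fin fA _ => n nA; rewrite /f memNset.
have M0 : 0 < 1 + tsum f by have := tsum_ge0 f0; lra.
exists (1 + tsum f)^-1; first by rewrite invr_gt0.
move=> n An; rewrite ler_pdivrMl//; have := tsum_ge_term n sf f0.
rewrite {1}/f mem_set// ler_pdivrMr// => h.
apply: (le_trans (ler_norm _)); apply: (le_trans h); rewrite ler_pM2r//; lra.
Qed.

Lemma clamp_lipschitz (a b : R) :
  `|Num.max 0 (Num.min 1 (2 - a)) - Num.max 0 (Num.min 1 (2 - b))| <= `|a - b|.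
Proof.
wlog ab : a b / a <= b.
  move=> H; have [/H//|/ltW/H] := leP a b.
  by rewrite distrC [leRHS]distrC.
rewrite [leRHS]distrC (ger0_norm (x := b - a)) ?subr_ge0// ler_norml.
by case: (leP 1 (2 - a)) => ?; case: (leP 1 (2 - b)) => ?;
  rewrite ?maxEle; do ?case: ifPn; rewrite -?ltNge; lra.
Qed.

(* IMS localization: where w (H_W w) <= 0, only the gradient of the cutoff chi
   contributes to the form at chi w. *)
Lemma cutoff_form W w chi (A : set Zd) : finite_set A ->
  (forall n, ~ A n -> chi n = 0) ->
  ip (fun n => chi n * w n) (hop W (fun n => chi n * w n)) =
  tsum (fun n => chi n ^+ 2 * (w n * hop W w n)) +
  \sum_(j < d) tsum (fun n => w n * w (n + delta j) * (chi n - chi (n + delta j)) ^+ 2).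
Proof.
move=> fA chi0.
have fin f : (forall n, ~ A n -> f n = 0) -> summ f by move=> f0; apply: summ_fin fA f0.
have finS e f : (forall n, ~ A n -> f n = 0) -> summ (fun n => f (n + e)).
  by move=> f0; apply: (summ_bij (shift_bij e)); exact: fin.
have ez f : summ (fun n => chi n * f n) by apply: fin => n /chi0 ->; rewrite mul0r.
pose f1 n := chi n ^+ 2 * w n; pose f2 n := chi n * w n.
have a1 e : summ (fun n => f1 n * w (n + e)).
  by apply: fin => n /chi0 c0; rewrite /f1 c0 expr0n !mul0r.
have a2 e : summ (fun n => f2 n * f2 (n + e)).
  by apply: fin => n /chi0 c0; rewrite /f2 c0 !mul0r.
have a1' e : summ (fun n => f1 (n + e) * w n).
  have : summ (fun n => f1 (n + e) * w (n + e - e)).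
    by apply: (finS e (fun n => f1 n * w (n - e))) => n /chi0 c0;
      rewrite /f1 c0 expr0n !mul0r.
  by congr summ; apply/funext => n; rewrite addrK.
have -> : ip (fun n => chi n * w n) (hop W (fun n => chi n * w n)) =
  tsum (fun n => chi n ^+ 2 * (w n * hop W w n)) + (ip f1 (adj w) - ip f2 (adj f2)).
  rewrite /ip -tsumB; last 2 first.
  - by apply: fin => n /chi0 c0; rewrite /f1 c0 expr0n !mul0r.
  - by apply: fin => n /chi0 c0; rewrite /f2 c0 !mul0r.
  rewrite -tsumD; last 2 first.
  - by apply: fin => n /chi0 c0; rewrite c0 expr0n !mul0r.
  - by apply: fin => n /chi0 c0; rewrite /f1 /f2 c0 expr0n !mul0r subr0.
  congr tsum; apply/funext => n; rewrite /hop /f1 -/f2 /f2; ring.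
rewrite !ip_adj// -sumrB; congr (_ + _); apply: eq_bigr => j _.
have a2' : summ (fun n => f2 (n + delta j) * f2 n).
  by have := a2 (delta j); congr summ; apply/funext => n; rewrite mulrC.
rewrite -tsumD// -tsumD// -tsumB; [|exact: summD|exact: summD].
(* The edge from n to m carries w(n) w(m) (chi(n)^2 + chi(m)^2 - 2 chi(n) chi(m)). *)
by congr tsum; apply/funext => n; rewrite /f1 /f2; ring.
Qed.

(** By the choice of c, the function w vanishes on the collar r <= |n| <= r + 1. Its truncation
    inside radius r is therefore not felt where w is positive: all neighbours of such a point have
    norm at least r, and w dominates c u - phi at them. *)
Lemma subsolution_le W phi u (r C : R) : nonneg_form W ->
  (forall n, 0 < phi n) -> (forall n, hop W phi n = 0) -> 0 < r ->
  (forall n, r <= enorm n -> u n ^+ 2 * enorm n ^+ d <= C) ->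
  (forall n, r + 1 <= enorm n -> hop W u n <= 0) ->
  exists2 c, 0 < c & forall n, r <= enorm n -> c * u n <= phi n.
Proof.
move=> W0 phi0 Hphi r0 uC' Hu.
have C0 : 0 <= `|C| by []; have uC n : r <= enorm n -> u n ^+ 2 * enorm n ^+ d <= `|C|.
  by move=> /uC' /le_trans; apply; rewrite ler_norm.
move: (`|C|) C0 uC => {uC'}C C0 uC.
have [c c0 cA] := small_multiple u (ball_finite (r + 1)) phi0.
exists c => //.
pose w n := if r <= enorm n then Num.max (c * u n - phi n) 0 else 0.
have w0 n : 0 <= w n by rewrite /w; case: ifP => // _; rewrite le_max lexx orbT.
have wge n : r <= enorm n -> c * u n - phi n <= w n.
  by move=> rn; rewrite /w rn le_max lexx.
suff wz n1 : w n1 = 0 by move=> n rn; rewrite -subr_le0 -(wz n) wge.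
have wHw n : w n * hop W w n <= 0.
  have [->|wn] := eqVneq (w n) 0; first by rewrite mul0r.
  have wp : 0 < w n by rewrite lt_neqAle eq_sym wn w0.
  have rn : r <= enorm n by move: wn; rewrite /w; case: ifP => //; rewrite eqxx.
  have r1n : r + 1 <= enorm n.
    rewrite leNgt; apply/negP => /ltW/cA; rewrite -subr_le0 => le0.
    by move: wn; rewrite /w rn max_r// eqxx.
  have wE : w n = c * u n - phi n.
    by move: wp; rewrite /w rn lt_max ltxx orbF => /ltW /max_l.
  rewrite pmulr_rle0//.
  apply: (@le_trans _ _ (c * hop W u n - hop W phi n)); last first.
    by rewrite Hphi subr0 pmulr_rle0// Hu.
  have : c * adj u n - adj phi n <= adj w n.
    rewrite /adj mulr_sumr -sumrB; apply: ler_sum => j _.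
    have nb p : c * u (n + step p) - phi (n + step p) <= w (n + step p).
      by apply: wge; apply: le_trans (enorm_step_ge n p); lra.
    by have := nb (j, true); have := nb (j, false); rewrite /step/=; lra.
  by rewrite /hop wE; lra.
have wu n : w n ^+ 2 <= c ^+ 2 * u n ^+ 2.
  rewrite /w; case: ifP => _; last by rewrite expr0n mulr_ge0// ?sqr_ge0.
  case: (leP (c * u n - phi n) 0) => [_|h]; first by rewrite expr0n mulr_ge0// ?sqr_ge0.
  rewrite -exprMn lerXn2r// ?nnegrE; [exact: ltW| |]; have := phi0 n; lra.
suff Hw n : hop W w n = 0.
  (* The zero to propagate is the origin, which is inside the truncation radius because r > 0. *)
  apply: (zero_propagates w0 Hw (n0 := 0)).
  rewrite /w; have -> : enorm (0 : Zd) = 0 :> R.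
    by rewrite /enorm big1 ?sqrtr0// => j _; rewrite mxE expr0n.
  by rewrite leNgt r0.
apply: (form_kernel (n := n) W0) => eps eps0.
(* The form at the cutoff will be at most B / N^2. The 11 comes from 4 N + 3 <= 11 (N - 1), where 4
   N + 3 is the side of the box carrying the gradient of chi and N - 1 a lower bound for the norms
   there. *)
pose B := c ^+ 2 * C * 11 ^+ d * d%:R.
have bd (x : R) : exists b : nat, x < b%:R.
  by exists (Num.bound `|x|); apply: le_lt_trans (ler_norm x) (archi_boundP _).
have [b1 b1P] := bd (B / eps); have [b2 b2P] := bd (enorm n + 1).
have [b3 b3P] := bd (r + 1).
(* N exceeds B / eps, makes chi equal to 1 at n and its neighbours, and keeps N - 1 >= r, where the
   decay of u is available. *)
pose N := (b1 + b2 + b3).+3.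
have NE : N%:R = b1%:R + b2%:R + b3%:R + 3 :> R by rewrite /N -addn3 !natrD.
have NB : B / eps < N%:R.
  by rewrite NE; have := ler0n R b2; have := ler0n R b3; lra.
have Nn : enorm n + 1 <= N%:R :> R.
  by rewrite NE; have := ler0n R b1; have := ler0n R b3; lra.
have Nr : r + 1 <= N%:R :> R.
  by rewrite NE; have := ler0n R b1; have := ler0n R b2; lra.
have N3 : 3 <= N%:R :> R by rewrite ler_nat /N.
have N0 : 0 < N%:R :> R by lra.
have iN : 0 <= N%:R^-1 :> R by rewrite invr_ge0 ltW.
pose chi m : R := Num.max 0 (Num.min 1 (2 - enorm m / N%:R)).
have chi1 m : enorm m <= N%:R :> R -> chi m = 1.
  move=> mN; have : enorm m / N%:R <= 1 :> R by rewrite ler_pdivrMr// mul1r.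
  by move=> h; rewrite /chi min_l ?max_r//; lra.
have chi0 m : 2 * N%:R <= enorm m :> R -> chi m = 0.
  move=> mN; have : 2 <= enorm m / N%:R :> R by rewrite ler_pdivlMr.
  by move=> h; rewrite /chi max_l// ge_min; apply/orP; right; lra.
have chiout m : ~ box (2 * N) m -> chi m = 0.
  move=> bm; apply: chi0; rewrite leNgt; apply/negP => /ltW mN; apply: bm.
  by apply: enorm_box; rewrite natrM.
have lip m j : (chi m - chi (m + delta j)) ^+ 2 <= N%:R^-1 ^+ 2.
  have h1 := enorm_step_le m (j, true); have h2 := enorm_step_ge m (j, true).
  have h3 : `|enorm m / N%:R - enorm (m + delta j) / N%:R| <= N%:R^-1 :> R.
    rewrite -mulrBl normrM (ger0_norm iN).
    rewrite ler_piMl//.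
    by move: h1 h2; rewrite /step/= => h1 h2; rewrite ler_norml; lra.
  rewrite -[leLHS]real_normK ?num_real// lerXn2r ?nnegrE//.
  exact: le_trans (clamp_lipschitz _ _) h3.
exists (fun m => chi m * w m); split.
- by apply: hdom_fin (box_finite (2 * N)) _ => m /chiout ->; rewrite mul0r.
- rewrite (cutoff_form _ _ (box_finite (2 * N)) chiout).
  have t1 : tsum (fun m => chi m ^+ 2 * (w m * hop W w m)) <= 0.
    rewrite -[leRHS](@tsum0 R Zd); apply: tsum_le; last 2 first.
    + exact: summ0.
    + by move=> m; exact: mulr_ge0_le0 (sqr_ge0 _) (wHw m).
    by apply: summ_fin (box_finite (2 * N)) _ => m /chiout ->; rewrite expr0n mul0r.
  have t2 (j : 'I_d) : tsum (fun m => w m * w (m + delta j) * (chi m - chi (m + delta j)) ^+ 2)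
      <= c ^+ 2 * C * 11 ^+ d / N%:R ^+ 2.
    have N10 : 0 < N%:R - 1 :> R by lra.
    apply: (@le_trans _ _ ((2 * (2 * N + 1)%:R + 1) ^+ d *
        (c ^+ 2 * C / (N%:R - 1) ^+ d / N%:R ^+ 2))).
      have K0 : 0 <= c ^+ 2 * C / (N%:R - 1) ^+ d / N%:R ^+ 2.
        by rewrite !mulr_ge0 ?invr_ge0 ?exprn_ge0// ltW.
      apply: tsum_box.
      + by move=> m; exact: mulr_ge0 (mulr_ge0 (w0 _) (w0 _)) (sqr_ge0 _).
      + move=> m bm; have mN : (2 * N + 1)%:R < enorm m :> R.
          by rewrite ltNge; apply/negP => /enorm_box.
        move: mN; rewrite natrD natrM => mN.
        have := enorm_step_ge m (j, true); rewrite /step/= => mj.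
        by rewrite !chi0 ?subrr ?expr0n ?mulr0//; lra.
      (* If chi differs at the two ends, one of them lies beyond radius N, hence both have norm at
         least N - 1. *)
      + move=> m; have [ee|ne] := eqVneq (chi m) (chi (m + delta j)).
          by rewrite ee subrr expr0n mulr0.
        have mN : N%:R - 1 <= enorm m :> R /\ N%:R - 1 <= enorm (m + delta j) :> R.
          have := enorm_step_le m (j, true); have := enorm_step_ge m (j, true).
          rewrite /step/= => h1 h2.
          have [h|h] := leP (enorm m) (N%:R : R); last by split; lra.
          have [h'|h'] := leP (enorm (m + delta j)) (N%:R : R); last by split; lra.
          by move: ne; rewrite !chi1// eqxx.
        have wb k : N%:R - 1 <= enorm k :> R -> w k ^+ 2 <= c ^+ 2 * C / (N%:R - 1) ^+ d.
          move=> Nk; apply: (le_trans (wu k)); rewrite -mulrA ler_pM2l ?exprn_gt0//.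
          rewrite ler_pdivlMr ?exprn_gt0//; apply: le_trans (uC k _); last by lra.
          by rewrite ler_wpM2l ?sqr_ge0// lerXn2r// nnegrE ?enorm_ge0// ltW.
        rewrite -exprVn; apply: ler_pM (lip m j); [exact: mulr_ge0|exact: sqr_ge0|].
        have := wb _ mN.1; have := wb _ mN.2; have := sqr_ge0 (w m - w (m + delta j)).
        nra.
    have -> : (2 * (2 * N + 1)%:R + 1) ^+ d * (c ^+ 2 * C / (N%:R - 1) ^+ d / N%:R ^+ 2) =
       c ^+ 2 * C * ((2 * (2 * N + 1)%:R + 1) / (N%:R - 1)) ^+ d / N%:R ^+ 2.
      by rewrite expr_div_n; ring.
    rewrite ler_pM2r ?invr_gt0 ?exprn_gt0// ler_wpM2l//.
      exact: mulr_ge0 (sqr_ge0 _) C0.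
    rewrite lerXn2r ?nnegrE//; first by rewrite divr_ge0// ltW.
    by rewrite ler_pdivrMr// natrD natrM; lra.
  apply: le_trans (lerD t1 (ler_sum _ (fun j _ => t2 j))) _.
  rewrite add0r sumr_const card_ord -[leLHS]mulr_natr.
  rewrite [leLHS](_ : _ = B / N%:R / N%:R); last by rewrite /B expr2 invfM; ring.
  rewrite ler_pdivrMr//; apply: (@le_trans _ _ eps).
    by rewrite ler_pdivrMr// mulrC -ler_pdivrMr// ltW.
  by rewrite ler_peMr ?ltW//; lra.
- have adjE : adj (fun m => chi m * w m) n = adj w n.
    apply: eq_bigr => j _.
    have := enorm_step_le n (j, true); have := enorm_step_le n (j, false); rewrite /step/=.
    by move=> h1 h2; rewrite !chi1 ?mul1r//; lra.
  by rewrite /hop adjE chi1 ?mul1r//; lra.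
Qed.

End GroundState.

(** * One-variable calculus *)

Section Calculus.
Context {R : realType}.
Implicit Types (f g : R -> R) (x t : R).

Definition drv x f df : Prop := is_derive (x : R) (1 : R) (f : R -> R) (df : R).

Lemma drv_eq x f a b : drv x f a -> a = b -> drv x f b.
Proof. by move=> h <-. Qed.

Lemma drvD x f g a b : drv x f a -> drv x g b -> drv x (fun y => f y + g y) (a + b).
Proof. by move=> fa gb; exact: is_deriveD. Qed.

Lemma drvM x f g a b : drv x f a -> drv x g b ->
  drv x (fun y => f y * g y) (a * g x + f x * b).
Proof.
by move=> fa gb; apply: (is_derive_eq (is_deriveM fa gb)); rewrite addrC mulrC.
Qed.

Lemma drvC x c : drv x (fun=> c) 0.
Proof. exact: is_derive_cst. Qed.

Lemma drvI x : drv x id 1.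
Proof. exact: is_derive_id. Qed.

Lemma drvZ x f a c : drv x f a -> drv x (fun y => c * f y) (c * a).
Proof. by move=> fa; apply: (drv_eq (drvM (drvC x c) fa)); rewrite mul0r add0r. Qed.

Lemma drvB x f g a b : drv x f a -> drv x g b -> drv x (fun y => f y - g y) (a - b).
Proof. by move=> fa gb; exact: is_deriveB. Qed.

Lemma drvBC x f a c : drv x f a -> drv x (fun y => f y - c) a.
Proof. by move=> fa; apply: (drv_eq (drvB fa (drvC x c))); rewrite subr0. Qed.

Lemma drvV x f a : f x != 0 -> drv x f a -> drv x (fun y => (f y)^-1) (- a / f x ^+ 2).
Proof.
move=> fx fa; apply: (is_derive_eq (is_deriveV fx fa)).
by rewrite /GRing.scale/= mulNr mulrC mulNr.
Qed.

Lemma drv_ln x f a : 0 < f x -> drv x f a -> drv x (fun y => ln (f y)) (a / f x).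
Proof.
move=> fx fa; have fln := is_derive1_ln fx.
by apply: (is_derive_eq (is_derive1_comp fln fa)); rewrite mulrC.
Qed.

Lemma drv_exp x f a : drv x f a -> drv x (fun y => expR (f y)) (a * expR (f x)).
Proof.
by move=> fa; apply: (is_derive_eq (is_derive1_comp (is_derive_expR (f x)) fa)); rewrite mulrC.
Qed.

Lemma drv_sum x (J : Type) (s : seq J) (F : J -> R -> R) (a : J -> R) :
  (forall j, drv x (F j) (a j)) ->
  drv x (fun y => \sum_(j <- s) F j y) (\sum_(j <- s) a j).
Proof.
move=> Fa; elim: s => [|j s IH].
  by rewrite big_nil; under eq_fun do rewrite big_nil; exact: drvC.
by rewrite big_cons; under eq_fun do rewrite big_cons; exact: drvD.
Qed.

Lemma mean_value (T : R) f df a b : (forall x, T <= x -> drv x f (df x)) ->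
  T <= a -> a < b -> exists c, [/\ a < c, c < b & f b - f a = df c * (b - a)].
Proof.
move=> fdf Ta ab.
have [c] : exists2 c, c \in `]a, b[%R & f b - f a = df c * (b - a).
  apply: MVT => // [x|].
    by rewrite in_itv/= => /andP[ax _]; apply: fdf; rewrite (le_trans Ta)// ltW.
  apply: derivable_within_continuous => x; rewrite in_itv/= => /andP[ax _].
  by have [] := fdf _ (le_trans Ta ax).
by rewrite in_itv/= => /andP[ac cb] e; exists c.
Qed.

Lemma primitive_sign (T : R) f df t : (forall x, T <= x -> drv x f (df x)) ->
  T <= t -> f t = 0 -> (forall x, T <= x -> 0 <= df x) ->
  forall x, T <= x -> (t <= x -> 0 <= f x) /\ (x <= t -> f x <= 0).
Proof.
move=> fdf Tt ft df0 x Tx; split; rewrite le_eqVlt => /orP[/eqP xt|xt].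
- by rewrite -xt ft.
- have [c [tc _]] := mean_value fdf Tt xt; rewrite ft subr0 => ->.
  by rewrite mulr_ge0 ?subr_ge0 ?df0 1?ltW// (le_lt_trans Tt).
- by rewrite xt ft.
- have [c [xc _]] := mean_value fdf Tx xt; rewrite ft sub0r => e.
  by rewrite -oppr_ge0 e mulr_ge0 ?subr_ge0 ?df0 1?ltW// (le_lt_trans Tx).
Qed.

Lemma primitive_ge0 (T : R) f df t : (forall x, T <= x -> drv x f (df x)) ->
  T <= t -> f t = 0 ->
  (forall x, T <= x -> (t <= x -> 0 <= df x) /\ (x <= t -> df x <= 0)) ->
  forall x, T <= x -> 0 <= f x.
Proof.
move=> fdf Tt ft df0 x Tx; case: (ltgtP x t) => [xt|xt|->]; last by rewrite ft.
- have [c [xc ct]] := mean_value fdf Tx xt; rewrite ft sub0r => e.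
  have [_ dc] := df0 c (le_trans Tx (ltW xc)).
  by rewrite -oppr_le0 e mulr_le0_ge0 ?dc ?subr_ge0 ?ltW.
- have [c [tc _]] := mean_value fdf Tt xt; rewrite ft subr0 => ->.
  have [dc _] := df0 c (le_trans Tt (ltW tc)).
  by rewrite mulr_ge0 ?dc ?subr_ge0 ?ltW.
Qed.

(** The sign of the fourth derivative is passed down: [r3] and [r1] have the sign of x - t, while
    [r2] and [r0] are nonnegative. Stopping at an odd order makes the bound valid for h of either
    sign. *)
Lemma taylor3 (T : R) (f0 f1 f2 f3 f4 : R -> R) :
  (forall x, T <= x -> drv x f0 (f1 x)) -> (forall x, T <= x -> drv x f1 (f2 x)) ->
  (forall x, T <= x -> drv x f2 (f3 x)) -> (forall x, T <= x -> drv x f3 (f4 x)) ->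
  (forall x, T <= x -> 0 <= f4 x) ->
  forall t h, T <= t -> T <= t + h ->
    f0 t + f1 t * h + f2 t * h ^+ 2 / 2 + f3 t * h ^+ 3 / 6 <= f0 (t + h).
Proof.
move=> d0 d1 d2 d3 f40 t h Tt Th.
have dl x : drv x (fun y => y - t) 1.
  by apply: (drv_eq (drvD (drvI x) (drvC x (- t)))); rewrite addr0.
have dsq x : drv x (fun y => (y - t) ^+ 2 / 2) (x - t).
  apply: (drv_eq (drvM (drvM (dl x) (dl x)) (drvC x 2^-1))) => /=.
  by field.
have dcb x : drv x (fun y => (y - t) ^+ 3 / 6) ((x - t) ^+ 2 / 2).
  apply: (drv_eq (drvM (drvM (dl x) (drvM (dl x) (dl x))) (drvC x 6^-1))) => /=.
  by field.
pose r3 x := f3 x - f3 t.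
pose r2 x := f2 x - f2 t - f3 t * (x - t).
pose r1 x := f1 x - f1 t - f2 t * (x - t) - f3 t * ((x - t) ^+ 2 / 2).
pose r0 x := f0 x - f0 t - f1 t * (x - t) - f2 t * ((x - t) ^+ 2 / 2)
             - f3 t * ((x - t) ^+ 3 / 6).
have e3 x : T <= x -> drv x r3 (f4 x) by move=> Tx; apply: drvBC; exact: d3.
have e2 x : T <= x -> drv x r2 (r3 x).
  move=> Tx; apply: (drv_eq (drvB (drvBC _ (d2 x Tx)) (drvZ (f3 t) (dl x)))).
  by rewrite mulr1.
have e1 x : T <= x -> drv x r1 (r2 x).
  move=> Tx; apply: (drv_eq (drvB (drvB (drvBC _ (d1 x Tx)) (drvZ (f2 t) (dl x)))
    (drvZ (f3 t) (dsq x)))).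
  by rewrite mulr1.
have e0 x : T <= x -> drv x r0 (r1 x).
  move=> Tx; apply: (drv_eq (drvB (drvB (drvB (drvBC _ (d0 x Tx))
    (drvZ (f1 t) (dl x))) (drvZ (f2 t) (dsq x))) (drvZ (f3 t) (dcb x)))).
  by rewrite mulr1.
have z3 : r3 t = 0 by rewrite /r3 subrr.
have z2 : r2 t = 0 by rewrite /r2 !subrr mulr0 subrr.
have z1 : r1 t = 0 by rewrite /r1 !subrr expr0n/= !mul0r !mulr0 !subr0.
have z0 : r0 t = 0 by rewrite /r0 !subrr !expr0n/= !mul0r !mulr0 !subr0.
have s2 := primitive_ge0 e2 Tt z2 (primitive_sign e3 Tt z3 f40).
have := primitive_ge0 e0 Tt z0 (primitive_sign e1 Tt z1 s2) Th.
by rewrite /r0 (addrC t h) addrK; lra.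
Qed.

End Calculus.

(** * Iterated logarithms and the weight as functions of |n|^2 *)

Section IteratedLog.
Context {R : realType}.
Implicit Types (f g : R -> R) (t : R).

(* The iterated logarithms log_(k+1) |n| as functions of t = |n|^2. *)
Definition ll (k : nat) t : R := iter k (@ln R) (ln t / 2).

(** With t = |n|^2 this is 1 / (log_1 |n| ... log_j |n|); divided by 2 t, it is the derivative of
    [ll j]. *)
Definition lp (j : nat) t : R := \prod_(k < j) (ll k t)^-1.

(** The logarithmic sum of the explicit potential. *)
Definition lsum (s : nat) t : R := \sum_(j < s) lp j.+1 t.

(** Image of [lsum] under - 2 t d/dt, see [lsum_theta]. *)
Definition msum (s : nat) t : R := \sum_(j < s) lp j.+1 t * lsum j.+1 t.

Lemma lsum0 : lsum 0 = fun=> 0.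
Proof. by apply/funext => t; rewrite /lsum big_ord0. Qed.

Lemma msum0 : msum 0 = fun=> 0.
Proof. by apply/funext => t; rewrite /msum big_ord0. Qed.

Lemma lsumS s : lsum s.+1 = fun t => lsum s t + lp s.+1 t.
Proof. by apply/funext => t; rewrite /lsum big_ord_recr. Qed.

Lemma msumS s : msum s.+1 = fun t => msum s t + lp s.+1 t * lsum s.+1 t.
Proof. by apply/funext => t; rewrite /msum big_ord_recr. Qed.

Lemma lpS j : lp j.+1 = fun t => lp j t * (ll j t)^-1.
Proof. by apply/funext => t; rewrite /lp big_ord_recr. Qed.

Lemma ll_iter_log k x : 0 < x -> iter_log k.+1 x = ll k (x ^+ 2).
Proof.
move=> x0; rewrite /iter_log /ll iterSr lnXn//; congr iter.
by rewrite -[X in X / 2]mulr_natr mulfK.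
Qed.

Lemma ll_large k (M : R) : exists T, forall t, T <= t -> M <= ll k t.
Proof.
elim: k M => [|k IH] M.
  exists (expR (2 * M)) => t tT; rewrite /ll/= ler_pdivlMr// mulrC.
  by rewrite -ler_expR lnK// posrE (lt_le_trans _ tT)// expR_gt0.
have [T TP] := IH (expR M); exists T => t /TP h.
by rewrite /ll iterS -/(ll k t) -ler_expR lnK// posrE (lt_le_trans _ h)// expR_gt0.
Qed.

(** Beyond T, all logarithms up to [ll K.+1] are taken at arguments at least 1, so the default value
    of [ln] never intervenes, and the factors of [lp] are positive and at most 1. *)
Definition large (K : nat) (T : R) : Prop :=
  1 <= T /\ forall t, T <= t -> forall k, (k <= K)%N -> 1 <= ll k t.

Lemma large_ex K (T0 : R) : exists2 T, large K T & T0 <= T.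
Proof.
elim: K => [|K [T [T1 TP] T0T]].
  have [T TP] := ll_large 0 1; exists (Num.max 1 (Num.max T T0)); last first.
    by rewrite !le_max lexx !orbT.
  split; first by rewrite le_max lexx.
  move=> t; rewrite !ge_max => /and3P[_ tT _] k; rewrite leqn0 => /eqP ->.
  exact: TP.
have [T' T'P] := ll_large K.+1 1; exists (Num.max T T'); last by rewrite le_max T0T.
split=> [|t]; first by rewrite le_max T1.
rewrite ge_max => /andP[tT tT'] k; rewrite leq_eqVlt => /orP[/eqP ->|kK].
  exact: T'P.
exact: TP.
Qed.

Section Large.
Context (K : nat) (T : R) (TK : large K T).

Let T_ge1 : 1 <= T := TK.1.

Let t_gt0 t : T <= t -> 0 < t.
Proof. by move=> tT; apply: lt_le_trans ltr01 (le_trans T_ge1 tT). Qed.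

Let ll_ge1 t k : T <= t -> (k <= K)%N -> 1 <= ll k t.
Proof. by move=> tT; exact: TK.2. Qed.

Let ll_gt0 t k : T <= t -> (k <= K)%N -> 0 < ll k t.
Proof. by move=> tT kK; exact: lt_le_trans (ll_ge1 tT kK). Qed.

Lemma lp_gt0 t j : T <= t -> (j <= K.+1)%N -> 0 < lp j t.
Proof.
move=> tT jK; apply: prodr_gt0 => i _; rewrite invr_gt0 ll_gt0//.
by have := ltn_ord i; lia.
Qed.

Lemma lp_le1 t j : T <= t -> (j <= K.+1)%N -> lp j t <= 1.
Proof.
move=> tT jK; apply: prodr_ile1 => i _.
have iK : (i <= K)%N by have := ltn_ord i; lia.
by rewrite invr_ge0 (ltW (ll_gt0 tT iK)) invf_le1 ?ll_ge1// ll_gt0.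
Qed.

Lemma ll_drv k t : (k <= K)%N -> T <= t -> drv t (ll k) (lp k t / (2 * t)).
Proof.
elim: k => [|k IH] kK tT; have t0 := t_gt0 tT.
  apply: (drv_eq (drvM (drv_ln t0 (drvI t)) (drvC t 2^-1))).
  by rewrite /lp big_ord0 mulr0 addr0 !mul1r invfM mulrC.
have kK' : (k <= K)%N by lia.
apply: (drv_eq (drv_ln (ll_gt0 tT kK') (IH kK' tT))).
by rewrite lpS mulrAC.
Qed.

(* g is the image of f under the derivation - 2 t d/dt. *)
Definition theta f g : Prop := forall t, T <= t -> drv t f (- g t / (2 * t)).

Lemma theta_cst c : theta (fun=> c) (fun=> 0).
Proof. by move=> t _; apply: (drv_eq (drvC t c)); rewrite oppr0 mul0r. Qed.

Lemma thetaD f f' g g' : theta f g -> theta f' g' ->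
  theta (fun t => f t + f' t) (fun t => g t + g' t).
Proof.
by move=> h h' t tT; apply: (drv_eq (drvD (h t tT) (h' t tT))); ring.
Qed.

Lemma thetaM f f' g g' : theta f g -> theta f' g' ->
  theta (fun t => f t * f' t) (fun t => g t * f' t + f t * g' t).
Proof.
by move=> h h' t tT; apply: (drv_eq (drvM (h t tT) (h' t tT))); ring.
Qed.

(** Logarithmic derivative: the factor 1 / [ll k] contributes [lp k] / [ll k], which is
    [lp k.+1]. *)
Lemma lp_theta j : (j <= K.+1)%N -> theta (lp j) (fun t => lp j t * lsum j t).
Proof.
elim: j => [|j IH] jK.
  have -> : lp 0 = (fun=> 1) by apply/funext => t; rewrite /lp big_ord0.
  move=> t _; apply: (drv_eq (drvC t 1)).
  by rewrite /lsum big_ord0 mulr0 oppr0 mul0r.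
have jK' : (j <= K)%N by lia.
rewrite lpS => t tT; have lj := ll_gt0 tT jK'.
apply: (drv_eq (drvM (IH (ltnW jK) t tT) (drvV (lt0r_neq0 lj) (ll_drv jK' tT)))).
rewrite lsumS lpS /=; field; rewrite (lt0r_neq0 lj)/=.
by rewrite lt0r_neq0// t_gt0.
Qed.

(* Being closed under sums and products, this class contains all coefficients
   in the derivatives of [weight], which gives their signs and bounds. *)
Fixpoint smooth (k : nat) f : Prop :=
  (exists C, forall t, T <= t -> 0 <= f t <= C) /\
  (if k is k'.+1 then exists2 g, theta f g & smooth k' g else True).

Lemma smooth_bound k f : smooth k f -> exists C, forall t, T <= t -> 0 <= f t <= C.
Proof. by case: k => [|k] []. Qed.

Lemma smoothW k f : smooth k.+1 f -> smooth k f.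
Proof.
elim: k f => [|k IH] f [fC [g fg sg]]; split=> //.
by exists g => //; exact: IH.
Qed.

Lemma smoothD k f f' : smooth k f -> smooth k f' -> smooth k (fun t => f t + f' t).
Proof.
elim: k f f' => [|k IH] f f' [[C fC] h] [[C' fC'] h']; split.
- by exists (C + C') => t tT; have := fC t tT; have := fC' t tT; lra.
- by [].
- by exists (C + C') => t tT; have := fC t tT; have := fC' t tT; lra.
- case: h h' => g fg sg [g' fg' sg'].
  by exists (fun t => g t + g' t); [exact: thetaD|exact: IH].
Qed.

Lemma smoothM k f f' : smooth k f -> smooth k f' -> smooth k (fun t => f t * f' t).
Proof.
elim: k f f' => [|k IH] f f' sf sf'.
  move: sf sf' => [[C fC] _] [[C' fC'] _]; split=> //.
  exists (C * C') => t tT; have /andP[? ?] := fC t tT; have /andP[? ?] := fC' t tT.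
  by rewrite mulr_ge0// ler_pM.
have wf := smoothW sf; have wf' := smoothW sf'.
move: sf sf' => [[C fC] [g fg sg]] [[C' fC'] [g' fg' sg']]; split.
  exists (C * C') => t tT; have /andP[? ?] := fC t tT; have /andP[? ?] := fC' t tT.
  by rewrite mulr_ge0// ler_pM.
exists (fun t => g t * f' t + f t * g' t); first exact: thetaM.
by apply: smoothD; exact: IH.
Qed.

Lemma smooth_cst k c : 0 <= c -> smooth k (fun=> c).
Proof.
elim: k c => [|k IH] c c0; split=> //; try by exists c => t _; rewrite c0 lexx.
by exists (fun=> 0); [exact: theta_cst|exact: IH].
Qed.

Lemma lp_smooth k j : (j <= K.+1)%N -> smooth k (lp j).
Proof.
elim: k j => [|k IH] j jK; split=> //; try by
  exists 1 => t tT; rewrite (ltW (lp_gt0 tT jK)) lp_le1.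
exists (fun t => lp j t * lsum j t); first exact: lp_theta.
apply: smoothM; first exact: IH.
elim: j jK => [|j IHj] jK; first by rewrite lsum0; exact: smooth_cst.
by rewrite lsumS; apply: smoothD; [apply: IHj; lia|exact: IH].
Qed.

Lemma lsum_smooth k s : (s <= K.+1)%N -> smooth k (lsum s).
Proof.
elim: s => [|s IH] sK; first by rewrite lsum0; exact: smooth_cst.
by rewrite lsumS; apply: smoothD; [apply: IH; lia|exact: lp_smooth].
Qed.

Lemma lsum_theta s : (s <= K.+1)%N -> theta (lsum s) (msum s).
Proof.
elim: s => [|s IH] sK; first by rewrite lsum0 msum0; exact: theta_cst.
rewrite lsumS msumS.
by apply: thetaD; [apply: IH; lia|exact: lp_theta].
Qed.

Lemma msum_smooth k s : (s <= K.+1)%N -> smooth k (msum s).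
Proof.
elim: s => [|s IH] sK; first by rewrite msum0; exact: smooth_cst.
rewrite msumS; apply: smoothD; first by apply: IH; lia.
by apply: smoothM; [exact: lp_smooth|exact: lsum_smooth].
Qed.

Section Weight.
Context (d s : nat) (sK : (s <= K)%N).

(* The weight |n|^(-d/2) (log_1 |n| ... log_s |n|)^(-1/2), in t = |n|^2. *)
Definition weight t : R :=
  expR (- (d%:R * ll 0 t + \sum_(i < s) ll i.+1 t) / 2).

Lemma weight_gt0 t : 0 < weight t. Proof. exact: expR_gt0. Qed.

Lemma weight_drv t : T <= t ->
  drv t weight (- ((d%:R + lsum s t) / 2) * weight t / (2 * t)).
Proof.
move=> tT.
have h : drv t (fun y => d%:R * ll 0 y + \sum_(i < s) ll i.+1 y)
    (d%:R * (lp 0 t / (2 * t)) + \sum_(i < s) lp i.+1 t / (2 * t)).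
  apply: drvD; first by apply: drvZ; exact: ll_drv.
  by apply: drv_sum => i; apply: ll_drv tT; have := ltn_ord i; lia.
have -> : weight = fun y =>
    expR (-1 * (d%:R * ll 0 y + \sum_(i < s) ll i.+1 y) * 2^-1).
  by apply/funext => y; rewrite /weight mulN1r.
apply: (drv_eq (drv_exp (drvM (drvZ (-1) h) (drvC t 2^-1)))).
by rewrite /= -mulr_suml -/(lsum s t) {1}/lp big_ord0 mulr0 addr0; ring.
Qed.

(** Differentiation preserves the shape a weight / (2 t)^k up to sign and sends a to g + (psi + 2 k)
    a, with psi = (d + [lsum s t]) / 2. If a and g are nonnegative, so is the new coefficient,
    whence the alternating signs. *)
Lemma weight_step k a g : theta a g -> forall t, T <= t ->
  drv t (fun t => a t * weight t / (2 * t) ^+ k)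
    (- ((g t + ((d%:R + lsum s t) / 2 + (2 * k)%:R) * a t) * weight t / (2 * t) ^+ k.+1)).
Proof.
move=> ag t tT; have t0 := t_gt0 tT; have tN0 : t != 0 by rewrite lt0r_neq0.
have dp : drv t (fun t => ((2 * t) ^+ k)^-1) (- (2 * k%:R) / (2 * t) ^+ k.+1).
  have d2 : drv t (fun t => 2 * t) (2 * 1) by apply: drvZ; exact: drvI.
  have dk : drv t (fun t => (2 * t) ^+ k) (k%:R * (2 * t) ^+ k.-1 * 2).
    elim: k => [|k IH]; first by rewrite !mul0r; exact: drvC.
    rewrite (_ : (fun t => _) = fun t => 2 * t * (2 * t) ^+ k); last first.
      by apply/funext => y; rewrite exprS.
    apply: (drv_eq (drvM d2 IH)).
    case: k {IH} => [|k] /=; first by rewrite expr0; ring.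
    by rewrite -[k.+2%:R]natr1 exprS; ring.
  apply: (drv_eq (drvV _ dk)); first by rewrite expf_neq0// mulf_neq0.
  by case: k {dk} => [|k]; rewrite /= ?exprS; [rewrite !mul0r !mulr0 oppr0 !mul0r|field];
    rewrite ?tN0 ?expf_neq0 ?mulf_neq0.
apply: (drv_eq (drvM (drvM (ag t tT) (weight_drv tT)) dp)).
rewrite natrM exprS; field; rewrite ?tN0 ?expf_neq0 ?mulf_neq0//.
Qed.

(** In terms of n: u^2 |n|^d = 1 / (log_1 |n| ... log_s |n|). This identity serves three times: for
    the decay of u, for the shape of [weight_ratio], and for the divergence of the sum of u^2. *)
Lemma weight_sqr t : T <= t -> weight t ^+ 2 * Num.sqrt t ^+ d = lp s t.
Proof.
move=> tT; have t0 := t_gt0 tT.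
rewrite /weight expr2 -expRD -mulrDl -mulr2n -[X in X / 2]mulr_natr mulfK//.
rewrite opprD expRD mulrAC.
have -> : Num.sqrt t ^+ d = expR (d%:R * ll 0 t).
  rewrite -[Num.sqrt t]lnK ?posrE ?sqrtr_gt0// -expRM_natl; congr (expR (_ * _)).
  rewrite /ll/= -[in RHS](sqr_sqrtr (ltW t0)) lnXn ?sqrtr_gt0//.
  by rewrite -[X in X / 2]mulr_natr mulfK.
rewrite -expRD addNr expR0 mul1r -sumrN.
elim: s sK => [|j IH] jK; first by rewrite big_ord0 expR0 /lp big_ord0.
rewrite big_ord_recr/= expRD IH ?lpS//; last by lia.
by rewrite expRN lnK// posrE ll_gt0//; lia.
Qed.

End Weight.
End Large.
End IteratedLog.

(** * The weight on the lattice and its Laplacian *)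

Section WeightOnLattice.
Context {R : realType} {d : nat}.
Local Notation Zd := 'rV[int]_d.
Implicit Types (n m : Zd) (t : R).

Lemma nonincreasing_drv (T : R) (f df : R -> R) : (forall x, T <= x -> drv x f (df x)) ->
  (forall x, T <= x -> df x <= 0) -> forall a b, T <= a -> a <= b -> f b <= f a.
Proof.
move=> fdf df0 a b Ta; rewrite le_eqVlt => /orP[/eqP ->//|ab].
have [c [ac _]] := mean_value fdf Ta ab; rewrite -subr_le0 => ->.
by rewrite mulr_le0_ge0 ?df0 ?subr_ge0 ?ltW// (le_lt_trans Ta).
Qed.

Definition latweight (s : nat) n : R := weight d s (enorm n ^+ 2).

(** Both sides are nonnegative, so comparing squares removes the power d / 2 and the square roots;
    [weight_sqr] then evaluates the quotient. *)
Lemma weight_ratioE (s : nat) (T : R) n m : large s T ->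
  T <= enorm n -> T <= enorm m ->
  weight_ratio s n m = latweight s m / latweight s n :> R.
Proof.
move=> TK nT mT; have [T1 llT] := TK.
have sq (k : Zd) : T <= enorm k :> R -> T <= enorm k ^+ 2 :> R.
  by move=> kT; have := le_trans T1 kT; nra.
have e0 (k : Zd) : T <= enorm k :> R -> 0 < enorm k :> R by move=> kT; lra.
have n0 := e0 _ nT; have m0 := e0 _ mT.
have ll0 (k : Zd) i : T <= enorm k :> R -> (i < s)%N -> 0 < ll i (enorm k ^+ 2) :> R.
  by move=> kT si; apply: lt_le_trans (llT _ (sq _ kT) _ (ltnW si)).
have wr0 : 0 <= weight_ratio s n m :> R.
  by rewrite mulr_ge0 ?powR_ge0// prodr_ge0// => i _; rewrite sqrtr_ge0.
have w0 : 0 <= latweight s m / latweight s n.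
  by rewrite divr_ge0// ltW// weight_gt0.
apply/eqP; rewrite -(@eqrXn2 _ 2)//; apply/eqP.
have W (k : Zd) : T <= enorm k -> latweight s k ^+ 2 = lp s (enorm k ^+ 2) / enorm k ^+ d :> R.
  move=> kT; have := weight_sqr TK d (leqnn s) (sq _ kT).
  rewrite sqrtr_sqr ger0_norm ?ltW ?e0// => <-.
  by rewrite mulfK// expf_neq0// lt0r_neq0 ?e0.
rewrite [RHS]expr_div_n (W m mT) (W n nT) {1}/weight_ratio [LHS]exprMn.
have -> : ((enorm n / enorm m) `^ (d%:R / 2)) ^+ 2 = enorm n ^+ d / enorm m ^+ d :> R.
  rewrite -powR_mulrn ?powR_ge0// -powRrM divfK ?pnatr_eq0//.
  by rewrite powR_mulrn ?divr_ge0 ?ltW// exprMn exprVn.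
have -> : (\prod_(1 <= i < s.+1) Num.sqrt (iter_log i (enorm n) / iter_log i (enorm m))) ^+ 2
    = (lp s (enorm n ^+ 2))^-1 * lp s (enorm m ^+ 2) :> R.
  rewrite -prodrXl big_add1 -[s.+1.-1]/s big_mkord /lp -prodfV -big_split.
  apply: eq_bigr => i _; have is' := ltn_ord i; rewrite -[RHS]/(_ * _).
  rewrite !ll_iter_log// invrK sqr_sqrtr ?divr_ge0// ltW// ll0//.
have lp0 : 0 < lp s (enorm n ^+ 2) := lp_gt0 TK (sq _ nT) (leqnSn s).
field; rewrite ?expf_neq0 ?lt0r_neq0//.
Qed.

(** Leading terms of the two sums, with [ll 0 t] = log |n|; they are the source of the surplus in
    [latweight_laplacian]. *)
Lemma lsum_ge (s : nat) (T : R) t : large s T -> (0 < s)%N -> T <= t ->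
  (ll 0 t)^-1 <= lsum s t /\ (ll 0 t)^-1 ^+ 2 <= msum s t.
Proof.
move=> TK; case: s TK => // s TK _ tT.
have lp0 j : (j <= s)%N -> 0 < lp j.+1 t by move=> js; apply: (lp_gt0 TK tT); lia.
have lpE : lp 1 t = (ll 0 t)^-1 by rewrite /lp big_ord_recl big_ord0 mulr1.
have ls j : (j <= s.+1)%N -> 0 <= lsum j t.
  by move=> js; apply: sumr_ge0 => i _; rewrite ltW// lp0//; have := ltn_ord i; lia.
split.
  rewrite /lsum big_ord_recl lpE lerDl sumr_ge0// => i _.
  by rewrite ltW// lp0//; rewrite lift0; exact: ltn_ord.
rewrite /msum big_ord_recl lpE lsumS lsum0 add0r lpE -expr2 lerDl sumr_ge0// => i _.
have := ltn_ord i => is'; rewrite mulr_ge0//.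
  by rewrite ltW// lp0//; rewrite lift0; exact: ltn_ord.
by apply: ls; rewrite lift0 ltnS; exact: ltn_ord.
Qed.

(** Square of log z = 2 log sqrt z <= 2 sqrt z. *)
Lemma ll0_sqr_le (z : R) : 1 <= z -> ll 0 (z ^+ 2) ^+ 2 <= 4 * z.
Proof.
move=> z1; have z0 : 0 < z by lra.
rewrite -ll_iter_log// /iter_log/=.
have w0 : 0 < Num.sqrt z by rewrite sqrtr_gt0.
have wz : Num.sqrt z ^+ 2 = z by rewrite sqr_sqrtr// ltW.
have lw : ln (Num.sqrt z) <= Num.sqrt z.
  by have := expR_ge1Dx (ln (Num.sqrt z)); rewrite lnK ?posrE//; lra.
have lw0 : 0 <= ln (Num.sqrt z).
  by rewrite ln_ge0// -(@ler_pXn2r _ 2) ?nnegrE ?sqrtr_ge0// wz expr1n.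
by rewrite -wz lnXn// -[in leLHS]mulr_natr; nra.
Qed.

(** Taylor expansion in t = |n|^2 with increments 1 + 2 n_j and 1 - 2 n_j. Write L and M for
    [lsum s t] and [msum s t]. The terms of order 1 / t in adj u / u - 2 d are (a_2 - d psi) / t,
    and a_2 - d psi = d (4 - d) / 4 + L + L^2 / 4 + M / 2, which is where the constants of the
    explicit potential come from. The condition s > 0 makes L^2 / 4 + M / 2 positive, as needed
    against terms of order 1 / t^2. *)
Lemma latweight_laplacian (s : nat) : (0 < s)%N -> exists r : R, forall n,
  r <= enorm n ->
  (2 * d%:R + (d%:R * (4 - d%:R) / 4 + lsum s (enorm n ^+ 2)) / enorm n ^+ 2) *
    latweight s n <= adj (latweight s) n.
Proof.
move=> s0; have [T TK _] := large_ex s (0 : R).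
have [T1 _] := TK; have sK := leqnn s.
pose psi := fun t => (d%:R + lsum s t) * 2^-1 : R.
have psi_smooth k : smooth T k psi.
  apply: smoothM; last by apply: smooth_cst; rewrite invr_ge0.
  by apply: smoothD; [apply: smooth_cst|apply: (lsum_smooth TK); lia].
pose dpsi := fun t => (0 + msum s t) * 2^-1 + (d%:R + lsum s t) * 0 : R.
have psi_theta : theta T psi dpsi.
  apply: thetaM; last exact: theta_cst.
  by apply: thetaD; [exact: theta_cst|apply: (lsum_theta TK); lia].
have dpsi_smooth k : smooth T k dpsi.
  apply: smoothD; apply: smoothM; try by apply: smooth_cst; rewrite ?invr_ge0.
    by apply: smoothD; [apply: smooth_cst|apply: (msum_smooth TK); lia].
  by apply: smoothD; [apply: smooth_cst|apply: (lsum_smooth TK); lia].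
have nextS k l a g : smooth T l a -> smooth T l g ->
    smooth T l (fun t => g t + (psi t + (2 * k)%:R) * a t).
  move=> sa sg; apply: smoothD => //; apply: smoothM => //.
  by apply: smoothD => //; exact: smooth_cst.
(* The k-th derivative of [weight] is (-1)^k a_k weight / (2 t)^k, with
   a_1 = psi. *)
pose a2 := fun t => dpsi t + (psi t + 2) * psi t : R.
have a2_smooth k : smooth T k a2 by exact: (nextS 1).
have [_ [g2 a2g2 g2s]] := a2_smooth 2.
pose a3 := fun t => g2 t + (psi t + 4) * a2 t : R.
have a3_smooth : smooth T 1 a3 by exact: (nextS 2).
have [_ [g3 a3g3 g3s]] := a3_smooth.
pose a4 := fun t => g3 t + (psi t + 6) * a3 t : R.
have a4_smooth : smooth T 0 a4 by apply: (nextS 3) => //; exact: smoothW.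
have [C2 a2B] := smooth_bound (a2_smooth 0).
have [C aB] := smooth_bound a3_smooth.
have [C4 a4B] := smooth_bound a4_smooth.
pose G := weight d s : R -> R.
pose D k (a : R -> R) := fun t => a t * G t / (2 * t) ^+ k.
have step0 t : T <= t -> drv t G (- D 1%N psi t).
  move=> tT; apply: (drv_eq (weight_drv TK d sK tT)).
  by rewrite /D /psi /G expr1 !mulNr.
have step1 t : T <= t -> drv t (fun t => - D 1%N psi t) (D 2 a2 t).
  move=> tT; have := drvZ (-1) (weight_step TK d sK 1 psi_theta tT).
  rewrite mulN1r opprK; under eq_fun do rewrite mulN1r.
  by move=> h; exact: h.
have step2 t : T <= t -> drv t (D 2 a2) (- D 3 a3 t).
  by move=> tT; have := weight_step TK d sK 2 a2g2 tT.
have step3 t : T <= t -> drv t (fun t => - D 3 a3 t) (D 4 a4 t).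
  move=> tT; have := drvZ (-1) (weight_step TK d sK 3 a3g3 tT).
  rewrite mulN1r opprK; under eq_fun do rewrite mulN1r.
  by move=> h; exact: h.
have G0 t : 0 < G t by exact: weight_gt0.
have D40 t : T <= t -> 0 <= D 4 a4 t.
  move=> tT; have /andP[a40 _] := a4B _ tT.
  by rewrite divr_ge0 ?mulr_ge0 ?exprn_ge0// ?mulr_ge0// ltW//; lra.
have tay := taylor3 step0 step1 step2 step3 D40.
(* T + 1 keeps the neighbours in the range of [tay]; the last summand is what [yz] turns into the
   bound [h3] on the remainder. *)
exists (T + 1 + 16 * `|C| * (d%:R + 1)) => n rn.
set z : R := enorm n in rn *; set t := z ^+ 2.
have Cd : 0 <= 16 * `|C| * (d%:R + 1) :> R by rewrite !mulr_ge0// addr_ge0.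
have zT : T + 1 <= z by lra.
have tz : z <= t by rewrite /t; nra.
have tT : T <= t by lra.
have t0 : 0 < t by lra.
have nbT p : T <= enorm (n + step p) ^+ 2 :> R.
  by have := enorm_step_ge (R := R) n p; rewrite -/z; nra.
(* With x = n_j, the two increments h = 1 + 2 x and h = 1 - 2 x have sums of h, h^2, h^3 equal to 2,
   2 + 8 x^2, 2 + 24 x^2. *)
pose A := 2 * G t - 2 * D 1%N psi t + D 2 a2 t - D 3 a3 t / 3.
pose B := 4 * D 2 a2 t - 4 * D 3 a3 t.
have low (j : 'I_d) : A + B * (n 0 j)%:~R ^+ 2 <=
    latweight s (n + delta j) + latweight s (n - delta j).
  have := nbT (j, true); have := nbT (j, false); rewrite /step/= enormD enormB -/z -/t.
  move=> /(tay _ _ tT) h1 /(tay _ _ tT) h2.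
  rewrite /latweight enormD enormB -/z -/t -/G; apply: le_trans (lerD h2 h1).
  by rewrite /A /B; lra.
apply: (@le_trans _ _ (\sum_(j < d) (A + B * (n 0 j)%:~R ^+ 2))); last exact: ler_sum.
rewrite big_split/= sumr_const card_ord -mulr_sumr -enorm_sqr -/z -/t.
rewrite -[A *+ d]mulr_natr /latweight -/z -/t -/G.
have [Ly My] := lsum_ge TK s0 tT.
have y0 : 0 < ll 0 t :> R by apply: lt_le_trans (TK.2 _ tT _ (leq0n s)).
(* Here y = 1 / log z, and (log z)^2 <= 4 z gives y^2 t >= z / 4. *)
have yz : 16 * `|C| * (d%:R + 1) <= 4 * ((ll 0 t)^-1 ^+ 2 * t).
  apply: (@le_trans _ _ z); first by lra.
  rewrite exprVn mulrA mulrAC ler_pdivlMr ?exprn_gt0//.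
  have := ll0_sqr_le (z := z); rewrite -/t => /(_ ltac:(lra)).
  by rewrite /t; nra.
move: Ly My yz; set y := (ll 0 t)^-1; set L := lsum s t; set M := msum s t => Ly My yz.
have yp : 0 < y by rewrite invr_gt0.
have psiE : psi t = (d%:R + L) / 2 by [].
have a2E : a2 t = M / 2 + ((d%:R + L) / 2 + 2) * ((d%:R + L) / 2).
  by rewrite /a2 /dpsi -/psi psiE -/M -/L; ring.
have /andP[a20 _] := a2B _ tT; have /andP[a30 a3C] := aB _ tT.
have d0 : 0 <= d%:R :> R by [].
have tN0 : t != 0 by rewrite lt0r_neq0.
(* The surplus M / 2 + L^2 / 4 >= (3 / 4) / (log |n|)^2 dominates the remainder,
   which is O(1 / t). *)
rewrite -subr_ge0 (_ : _ - _ = G t / t * (M / 2 + L ^+ 2 / 4 + d%:R * a2 t / (4 * t)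
   - a3 t * (d%:R / (24 * t ^+ 2) + 1 / (2 * t)))); last first.
  rewrite /A /B /D psiE a2E; field; exact: tN0.
have G0' := ltW (G0 t); have t0' := ltW t0.
apply: mulr_ge0; first exact: divr_ge0.
have h1 : 0 <= d%:R * a2 t / (4 * t) by rewrite divr_ge0// mulr_ge0.
have h2 : a3 t * (d%:R / (24 * t ^+ 2) + 1 / (2 * t)) <= `|C| * (d%:R + 1) / t.
  rewrite -mulrA; apply: ler_pM => //.
  - by rewrite addr_ge0// divr_ge0// mulr_ge0// exprn_ge0.
  - exact: le_trans a3C (ler_norm _).
  - rewrite ler_pdivlMr// [leLHS](_ : _ = d%:R / (24 * t) + 1 / 2); last by field.
    apply: lerD; last by lra.
    by rewrite ler_pdivrMr ?mulr_gt0//; nra.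
have h3 : `|C| * (d%:R + 1) / t <= y ^+ 2 / 4 by rewrite ler_pdivrMr//; lra.
have h4 : y ^+ 2 <= L ^+ 2 by nra.
have := sqr_ge0 y; lra.
Qed.

End WeightOnLattice.

(** * Divergence of the sum of u^2 *)

Section Divergence.
Context {R : realType} {d' : nat}.
Local Notation d := d'.+1.
Local Notation Zd := 'rV[int]_d.
Implicit Types (n : Zd) (t : R).

Definition layer_point (k : nat) (b : {ffun 'I_d' -> 'I_k}) : Zd :=
  \row_j (if unlift ord0 j is Some i then (b i : nat)%:Z else k%:Z).

(** Layers stand in for spheres: they are disjoint, being told apart by the first coordinate, have
    exactly k^(d-1) points, and satisfy k^2 <= |n|^2 <= d k^2. *)
Definition layer (k : nat) : set Zd :=
  [set layer_point b | b in [set: {ffun 'I_d' -> 'I_k}]].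

Lemma layer_finite k : finite_set (layer k).
Proof. by apply: finite_image; exact: finite_finset. Qed.

Lemma layer_first k n : layer k n -> n 0 ord0 = k%:Z.
Proof. by move=> [b _ <-]; rewrite mxE unlift_none. Qed.

Lemma layer_enorm k n : layer k n ->
  k%:R ^+ 2 <= enorm (R := R) n ^+ 2 <= d%:R * k%:R ^+ 2.
Proof.
move=> [b _ <-]; rewrite enorm_sqr big_ord_recl mxE unlift_none -pmulrn.
apply/andP; split; first by rewrite lerDl sumr_ge0// => i _; rewrite sqr_ge0.
rewrite -natr1 mulrDl mul1r addrC lerD2r mulr_natl -[X in _ *+ X]card_ord -sumr_const.
apply: ler_sum => i _; rewrite mxE liftK -pmulrn lerXn2r ?nnegrE// ler_nat ltnW//.
Qed.

Lemma tsum_layer k (f : Zd -> R) (c : R) : (forall n, 0 <= f n) ->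
  (forall n, layer k n -> c <= f n) ->
  k%:R ^+ d' * c <= tsum (fun n => if n \in layer k then f n else 0).
Proof.
move=> f0 fc; rewrite (tsum_fset (layer_finite k)); last 2 first.
- by move=> n; case: ifP.
- by move=> n nl; rewrite memNset.
rewrite fsbig_image; last first.
  move=> b b' _ _ /rowP e; apply/ffunP => i; apply/val_inj.
  by have := e (lift ord0 i); rewrite !mxE liftK => -[].
rewrite (_ : [set: _] = [set` index_enum {ffun 'I_d' -> 'I_k}]); last first.
  by apply/seteqP; split=> b //= _; rewrite mem_index_enum.
rewrite -fsbig_seq ?index_enum_uniq//.
apply: (@le_trans _ _ (\sum_(b : {ffun 'I_d' -> 'I_k}) c)).
  by rewrite sumr_const card_ffun !card_ord -[leRHS]mulr_natl natrX.
apply: ler_sum => b _; have lb : layer k (layer_point b) by exists b.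
by rewrite mem_set//; exact: fc.
Qed.

Lemma sum_layers_le (f : Zd -> R) (k0 m : nat) n : 0 <= f n ->
  \sum_(i < m) (if n \in layer (k0 + i) then f n else 0) <= f n.
Proof.
move=> f0; case: (boolP [exists i : 'I_m, n \in layer (k0 + i)]) => [/existsP[i ni]|].
  rewrite (bigD1 i)//= ni big1 ?addr0// => j ji.
  case: ifPn => //; rewrite inE => /layer_first nj.
  move: ni; rewrite inE => /layer_first; rewrite nj => -[/addnI/val_inj e].
  by rewrite e eqxx in ji.
move=> /existsPn ni; rewrite big1// => i _.
by rewrite (negbTE (ni i)).
Qed.

(** By the mean value theorem and the decrease of the derivative, the increment is at most d (2 k +
    1) [lp s t] / (2 t) <= (3/2) [lp s t] / k, as k >= 1. By [weight_sqr] with sqrt t = k sqrt d,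
    this is a constant times the share k^(d-1) u^2 of a layer; summed over k, the left side
    telescopes. *)
Lemma ll_increment (s : nat) (T : R) (k : nat) : large s T -> T <= k%:R ->
  ll s (d%:R * k.+1%:R ^+ 2) - ll s (d%:R * k%:R ^+ 2) <=
  3 / 2 * Num.sqrt d%:R ^+ d * (k%:R ^+ d' * weight d s (d%:R * k%:R ^+ 2) ^+ 2) :> R.
Proof.
move=> TK Tk; have T1 := TK.1; set t := d%:R * k%:R ^+ 2.
have d1 : 1 <= d%:R :> R by rewrite ler1n.
have k1 : 1 <= k%:R :> R by lra.
have tT : T <= t by rewrite /t; nra.
have tt : t < d%:R * k.+1%:R ^+ 2 by rewrite /t -natr1; nra.
have lps := ltnW (ltnSn s).
have [c [tc _ ->]] := mean_value (fun x => ll_drv TK (leqnn s) (t := x)) tT tt.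
have lpc : lp s c <= lp s t.
  apply: (nonincreasing_drv (lp_theta TK lps) _ tT (ltW tc)) => x xT.
  have x0 : 0 <= x by lra.
  rewrite mulNr oppr_le0 divr_ge0 ?mulr_ge0// ?(ltW (lp_gt0 TK xT lps))//.
  apply: sumr_ge0 => i _; apply/ltW/(lp_gt0 TK xT).
  by have := ltn_ord i; lia.
have t0 : 0 < t by lra.
have lp0 := lp_gt0 TK tT lps.
apply: (@le_trans _ _ (lp s t / (2 * t) * (d%:R * k.+1%:R ^+ 2 - t))).
  rewrite ler_pM2r ?subr_gt0//; apply: ler_pM => //.
  - by rewrite ltW// (lp_gt0 TK)//; lra.
  - by rewrite invr_ge0; lra.
  - by rewrite lef_pV2 ?posrE; lra.
have := weight_sqr TK d (leqnn s) tT.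
have -> : Num.sqrt t = Num.sqrt d%:R * k%:R.
  by rewrite /t sqrtrM// sqrtr_sqr ger0_norm.
rewrite exprMn [k%:R ^+ d'.+1]exprS => lpE.
have -> : 3 / 2 * Num.sqrt d%:R ^+ d * (k%:R ^+ d' * weight d s t ^+ 2) =
    3 / 2 * lp s t / k%:R :> R.
  by rewrite -lpE; field; lra.
rewrite /t -[k.+1%:R]natr1.
rewrite (_ : lp s t / _ * _ = lp s t * ((2 * k%:R + 1) / 2 / k%:R ^+ 2)); last first.
  by rewrite /t; field; lra.
rewrite (_ : 3 / 2 * lp s _ / _ = lp s t * (3 / 2 / k%:R)); last by rewrite /t; ring.
rewrite ler_pM2l// ler_pdivrMr ?exprn_gt0//; last by lra.
rewrite [leRHS](_ : _ = 3 / 2 * k%:R); last by field; lra.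
by lra.
Qed.

Lemma latweight_not_summable (s : nat) (r : R) :
  ~ summ (fun n : Zd => if r <= enorm n then latweight s n ^+ 2 else 0 : R).
Proof.
set f := (fun n => _) => sf.
have f0 n : 0 <= f n by rewrite /f; case: ifP => // _; rewrite sqr_ge0.
have [T TK rT] := large_ex s r; have T1 := TK.1.
have [k0 Tk0] : exists k0 : nat, T <= k0%:R.
  exists (Num.bound T); apply/ltW/archi_boundP; lra.
have Tk i : T <= (k0 + i)%:R by rewrite natrD (le_trans Tk0)// lerDl.
pose w i : R := (k0 + i)%:R ^+ d' * weight d s (d%:R * (k0 + i)%:R ^+ 2) ^+ 2.
(* The weight decreases in t, so its value at the largest possible |n|^2 in the layer is a lower
   bound. *)
have fl i n : layer (k0 + i) n -> weight d s (d%:R * (k0 + i)%:R ^+ 2) ^+ 2 <= f n.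
  move=> ln; have /andP[lo hi] := layer_enorm ln.
  have nT : T <= enorm n :> R.
    apply: le_trans (Tk i) _.
    by rewrite -(@ler_pXn2r _ 2) ?nnegrE ?enorm_ge0.
  rewrite /f (le_trans rT nT) lerXn2r ?nnegrE ?(ltW (weight_gt0 _ _ _))//.
  apply: (nonincreasing_drv (weight_drv TK d (leqnn s)) _ _ hi); last by nra.
  move=> x xT; rewrite !mulNr oppr_le0 divr_ge0//; last by lra.
  rewrite mulr_ge0 ?(ltW (weight_gt0 _ _ _))// divr_ge0// addr_ge0// sumr_ge0// => j _.
  by rewrite ltW// (lp_gt0 TK xT)//; have := ltn_ord j; lia.
have bound m : \sum_(i < m) w i <= tsum f.
  pose F i n := if n \in layer (k0 + i) then f n else 0.
  have sF i : summ (F i).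
    by apply: summ_fin (layer_finite (k0 + i)) _ => n nl; rewrite /F memNset.
  apply: (@le_trans _ _ (tsum (fun n => \sum_(i < m) F i n))).
    by rewrite tsum_sum//; apply: ler_sum => i _; exact: tsum_layer (fl i).
  apply: tsum_le => //; first exact: summ_sum.
  by move=> n; exact: sum_layers_le.
pose C := 3 / 2 * Num.sqrt d%:R ^+ d : R.
pose l k := ll s (d%:R * k%:R ^+ 2) : R.
have C0 : 0 <= C by rewrite !mulr_ge0// exprn_ge0// sqrtr_ge0.
have grow m : l (k0 + m)%N - l k0 <= C * tsum f.
  apply: le_trans (_ : C * \sum_(i < m) w i <= _); last by rewrite ler_wpM2l.
  elim: m => [|m IH]; first by rewrite addn0 subrr big_ord0 mulr0.
  rewrite big_ord_recr/= mulrDr addnS.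
  have := ll_increment TK (Tk m); rewrite -/C -/(w m) -/(l (k0 + m)%N).
  by rewrite -/(l (k0 + m).+1); lra.
have [T' T'P] := ll_large s (C * tsum f + l k0 + 1).
have [m T'm] : exists m : nat, T' <= d%:R * (k0 + m)%:R ^+ 2.
  exists (Num.bound `|T'|); set m := Num.bound _.
  have mT : `|T'| < m%:R by exact: archi_boundP.
  have d1 : 1 <= d%:R :> R by rewrite ler1n.
  have km : m%:R <= (k0 + m)%:R :> R by rewrite ler_nat leq_addl.
  have kk : 1 <= (k0 + m)%:R :> R by have := Tk m; lra.
  have kk2 : (k0 + m)%:R <= (k0 + m)%:R ^+ 2 :> R by rewrite expr2 ler_peMr.
  have dk2 : (k0 + m)%:R ^+ 2 <= d%:R * (k0 + m)%:R ^+ 2 :> R by rewrite ler_peMl// sqr_ge0.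
  by have := ler_norm T'; lra.
by have := T'P _ T'm; have := grow m; rewrite -/(l (k0 + m)%N); lra.
Qed.

End Divergence.

Lemma latweight_diverges {R : realType} (d s : nat) (r : R) : (0 < d)%N ->
  ~ summ (fun n : 'rV[int]_d => if r <= enorm n then latweight s n ^+ 2 else 0 : R).
Proof. by case: d => // d' _; exact: latweight_not_summable. Qed.

(** * From the spectral hypotheses to the two criteria *)

Section Assembly.
Context {R : realType} {d : nat}.
Local Notation Zd := 'rV[int]_d.
Implicit Types (n : Zd) (V : Zd -> R).

(** The real or the imaginary part is nonzero, and each solves the same real equation;
    multiplication by [checker] moves the eigenvalue 4d to 0. *)
Lemma eigenfunction V : point_spectrum (schrodinger V) (4 * d%:R) ->
  exists f : Zd -> R, [/\ hdom (fun n => - V n) f, f <> (fun=> 0) &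
    forall n, hop (fun n => - V n) f n = 0].
Proof.
move=> [psi [psiD psiN0 psiE]].
have part (r : R[i] -> R) : real_part r -> (fun n => r (psi n)) <> (fun=> 0) ->
    exists f : Zd -> R, [/\ hdom (fun n => - V n) f, f <> (fun=> 0) &
    forall n, hop (fun n => - V n) f n = 0].
  move=> rP rN0; pose g n := checker n * r (psi n).
  have ck n : checker n * checker n = 1 :> R by rewrite -expr2 checker_sqr.
  have gE : (fun n => checker n * g n) = (fun n => r (psi n)).
    by apply/funext => n; rewrite /g mulrA ck mul1r.
  exists g; split.
  - apply: (hdomN _ _).1; apply: checker_dom; exact: real_part_dom.
  - move=> g0; apply: rN0; rewrite -gE; apply/funext => n.
    by rewrite (congr1 (fun f => f n) g0) mulr0.
  - move=> n; have := checker_hop V g n; rewrite gE -real_part_hop// psiE.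
    have [_ rZ _] := rP.
    rewrite (_ : 4 * d%:R * psi n = ((4 * d%:R : R)%:C)%C * psi n); last first.
      by rewrite rmorphM !rmorph_nat.
    rewrite rZ (_ : r (psi n) = checker n * g n); last by rewrite /g mulrA ck mul1r.
    set H := hop _ g n => E.
    have cH : checker n * H = 0 by move: E; rewrite mulrBr; lra.
    by rewrite -[H]mul1r -(ck n) -mulrA cH mulr0.
case: (pselect ((fun n => complex.Re (psi n)) = (fun=> 0))) => [re0|]; last first.
  by apply: part; exact: real_part_Re.
apply: (part _ real_part_Im) => im0; apply: psiN0; apply/funext => n.
have := congr1 (fun f => f n) re0; have := congr1 (fun f => f n) im0.
by move=> /=; case: (psi n) => a b /= -> ->.
Qed.

Lemma weight_criterion V (s : nat) : (0 < d)%N ->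
  for_large (R := R) (fun n => V n >= 2 * d%:R -
    \sum_(j < d) (weight_ratio s n (n + delta j) + weight_ratio s n (n - delta j))) ->
  point_spectrum (schrodinger V) (4 * d%:R) ->
  (4 * d%:R : R)%:E <> sup_spectrum (schrodinger V).
Proof.
move=> d0 [r0 Vlarge] /eigenfunction[f [Df fN0 Hf]] /hop_le/checker_form form.
have [phi [phi2 phi0 Hphi]] := ground_state form Df Hf fN0.
have [T TK rT] := large_ex s r0; have T1 := TK.1.
have w0 n : 0 < latweight s n :> R by exact: weight_gt0.
have T0 : 0 < T by lra.
have sq n : T <= enorm n :> R -> T <= enorm n ^+ 2 by nra.
have lps := ltnW (ltnSn s).
have wdecay n : T <= enorm n -> latweight s n ^+ 2 * enorm n ^+ d <= 1 :> R.
  move=> nT; have := weight_sqr TK d (leqnn s) (sq _ nT).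
  rewrite sqrtr_sqr ger0_norm ?enorm_ge0// => ->.  exact: (lp_le1 TK (sq _ nT) lps).
(* Multiplied by u_n > 0 and rewritten with [weight_ratioE], the assumption on V at n is exactly
   this inequality; T + 1 ensures that the neighbours are also beyond T. *)
have sub n : T + 1 <= enorm n -> hop (fun n => - V n) (latweight s) n <= 0.
  move=> nT; have nT' : T <= enorm n by lra.
  have nb p : T <= enorm (n + step p) :> R.
    by apply: le_trans (enorm_step_ge n p); lra.
  have := Vlarge n (le_trans rT nT').
  rewrite (eq_bigr (fun j => (latweight s (n + delta j) + latweight s (n - delta j))
      / latweight s n)); last first.
    move=> j _; have := nb (j, true); have := nb (j, false); rewrite /step/= => h1 h2.
    by rewrite !(weight_ratioE TK)// mulrDl.
  rewrite -mulr_suml -/(adj _ n) lerBlDr -lerBlDl ler_pdivlMr//.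
  by rewrite /hop; lra.
have [c c0 cphi] := subsolution_le form phi0 Hphi T0 wdecay sub.
apply: (latweight_diverges d0 (s := s) (r := T)).
apply: summ_le (summZ (c ^- 2) phi2) => n.
have cc : 0 < c ^+ 2 by rewrite exprn_gt0.
rewrite ler_pdivlMl//; case: ifP => [nT|_]; last by rewrite normr0 mulr0 sqr_ge0.
rewrite ger0_norm ?sqr_ge0// -exprMn lerXn2r ?nnegrE ?cphi// ltW//.
by rewrite mulr_gt0.
Qed.

(** Passing to s + 1 meets the condition of at least one logarithm in [latweight_laplacian] even for
    s = 0; the additional term [lp s.+1 t] / t is nonnegative and is discarded. *)
Lemma explicit_potential V (s : nat) :
  for_large (R := R) (fun n => V n >= - (d%:R * (4 - d%:R) / (4 * enorm n ^+ 2)) -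
    (enorm n ^+ 2)^-1 *
    \sum_(1 <= j < s.+1) \prod_(1 <= k < j.+1) (iter_log k (enorm n))^-1) ->
  for_large (R := R) (fun n => V n >= 2 * d%:R -
    \sum_(j < d) (weight_ratio s.+1 n (n + delta j) + weight_ratio s.+1 n (n - delta j))).
Proof.
move=> [r0 Vlarge]; have [r lap] := @latweight_laplacian R d s.+1 isT.
have [T TK rT] := large_ex s.+1 (Num.max r0 r); have T1 := TK.1.
move: rT; rewrite ge_max => /andP[r0T rT].
exists (T + 1) => n nT; have nT' : T <= enorm n by lra.
have nb p : T <= enorm (n + step p) :> R.
  by apply: le_trans (enorm_step_ge n p); lra.
rewrite (eq_bigr (fun j => (latweight s.+1 (n + delta j) + latweight s.+1 (n - delta j))
    / latweight s.+1 n)); last first.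
  move=> j _; have := nb (j, true); have := nb (j, false); rewrite /step/= => h1 h2.
  by rewrite !(weight_ratioE TK)// mulrDl.
rewrite -mulr_suml -/(adj _ n).
have w0 : 0 < latweight s.+1 n :> R by exact: weight_gt0.
have := lap n (le_trans rT nT'); rewrite -ler_pdivlMr// => {}lap.
apply: le_trans (Vlarge n (le_trans r0T nT')).
have e0 : 0 < enorm n :> R by lra.
have -> : \sum_(1 <= j < s.+1) \prod_(1 <= k < j.+1) (iter_log k (enorm n))^-1 =
    lsum s (enorm n ^+ 2) :> R.
  rewrite big_add1 -[s.+1.-1]/s big_mkord; apply: eq_bigr => j _.
  rewrite big_add1 -[j.+2.-1]/j.+1 big_mkord; apply: eq_bigr => k _.
  by rewrite ll_iter_log.
move: lap; rewrite lsumS; set t := enorm n ^+ 2 => lap.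
have tT : T <= t by rewrite /t; nra.
have t0 : 0 < t by lra.
have lp0 : 0 <= lp s.+1 t / t by rewrite divr_ge0 ?ltW// (lp_gt0 TK tT (leqnSn _)).
have -> : d%:R * (4 - d%:R) / (4 * t) = d%:R * (4 - d%:R) / 4 / t by rewrite invfM mulrA.
have -> : t^-1 * lsum s t = lsum s t / t by rewrite mulrC.
by move: lap; rewrite !mulrDl; lra.
Qed.

End Assembly.

Theorem theorem16 (R : realType) (d : nat) (hd : (0 < d)%N)
    (V : 'rV[int]_d -> R) :
  ((exists s : nat, for_large (R := R) (fun n : 'rV[int]_d =>
      V n >= 2 * d%:R -
        \sum_(j < d) (weight_ratio s n (n + delta j) +
                      weight_ratio s n (n - delta j)))) ->
    ~ point_spectrum (schrodinger V) (4 * d%:R) \/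
    (4 * d%:R : R)%:E <> sup_spectrum (schrodinger V))
  /\
  ((exists s : nat, for_large (R := R) (fun n : 'rV[int]_d =>
      V n >= - (d%:R * (4 - d%:R) / (4 * enorm n ^+ 2)) -
        (enorm n ^+ 2)^-1 *
        \sum_(1 <= j < s.+1) \prod_(1 <= k < j.+1)
          (iter_log k (enorm n))^-1)) ->
    ~ point_spectrum (schrodinger V) (4 * d%:R) \/
    (4 * d%:R : R)%:E <> sup_spectrum (schrodinger V)).
Proof.
have criterion : (exists s : nat, for_large (R := R) (fun n : 'rV[int]_d =>
      V n >= 2 * d%:R -
        \sum_(j < d) (weight_ratio s n (n + delta j) +
                      weight_ratio s n (n - delta j)))) ->
    ~ point_spectrum (schrodinger V) (4 * d%:R) \/
    (4 * d%:R : R)%:E <> sup_spectrum (schrodinger V).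
  move=> [s Vs]; have [eig|] := pselect (point_spectrum (schrodinger V) (4 * d%:R)).
    by right; exact: weight_criterion Vs eig.
  by left.
split=> // -[s Vs]; apply: criterion.
by exists s.+1; exact: explicit_potential.
Qed.
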